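(* Let $a>0$ and let $A=\{A_{jk}\}_{j,k=1}^{\infty}$ be a semi-infinite matrix of independent complex Gaussian random variables with $$\mathbf{E}(A_{jk})=\mathbf{E}(A_{jk}^2)=0,\qquad \mathbf{E}(|A_{jk}|^2)=2a^2.$$ For each $n$ let $A_n=\{A_{jk}\}_{j,k=1}^n$ and let $M_n=\frac1nA_nA_n^*$ (the Laguerre ensemble). Let $N_n$ be the normalized eigenvalue counting measure of $M_n$. Then, with probability 1, $N_n$ converges weakly as $n\to\infty$ to the nonrandom measure $$N_L(\Delta)=\frac{1}{4\pi a^2}\int_{\Delta\cap[0,8a^2]}\sqrt{\frac{8a^2-\lambda}{\lambda}}\,d\lambda,\qquad \Delta\subset\mathbf{R}\ \text{Borel}.$$
   Context: For a Hermitian $n\times n$ matrix $M_n$ with eigenvalues $\lambda_1^{(n)},\dots,\lambda_n^{(n)}$ (counted with multiplicity), the normalized eigenvalue counting measure is $N_n(\Delta)=\frac1n\#\{i:\lambda_i^{(n)}\in\Delta\}$ for Borel $\Delta\subset\mathbf{R}$. The law of $A_n$ is equivalently $Z_n^{-1}\exp\left(-\frac{1}{2a^2}\operatorname{Tr}AA^*\right)dA$ with $dA=\prod_{j,k=1}^n d\,\mathrm{Re}A_{jk}\,d\,\mathrm{Im}A_{jk}$. All the $A_n$ are defined on the common probability space of semi-infinite matrices $A$ with the infinite product Gaussian measure. *)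

(* Defs.v *)
From HB Require Import structures.
From mathcomp Require Import all_boot all_order all_algebra.
From mathcomp Require Import complex.
From mathcomp Require Import all_classical all_reals all_analysis.
From mathcomp Require Import measurable_realfun.

Set Implicit Arguments.
Unset Strict Implicit.
Unset Printing Implicit Defensive.

Import Order.TTheory GRing.Theory Num.Theory.
Import numFieldNormedType.Exports.

Local Open Scope classical_set_scope.
Local Open Scope ring_scope.
Local Open Scope complex_scope.
Local Open Scope sesquilinear_scope.

(* [Re] and [Im] alone denote the R[i]-valued ['Re] and ['Im] of
   [Num.Theory]; here the R-valued projections are needed. *)
Local Notation cRe := complex.Re.
Local Notation cIm := complex.Im.

Section complex_random_variables.
Context {d : measure_display} {Omega : measurableType d} {R : realType}.
Variable P : probability Omega R.

Definition complex_rv (X : Omega -> R[i]) : Prop :=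
  measurable_fun setT (fun w => cRe (X w)) /\
  measurable_fun setT (fun w => cIm (X w)).

Definition cexpectation (X : Omega -> R[i]) : R[i] :=
  fine 'E_P[fun w => cRe (X w)]%E +i* fine 'E_P[fun w => cIm (X w)]%E.

(* [normal_prob m 0] is not the degenerate Gaussian law, which is therefore
   added explicitly. *)
Definition gaussian_law (m s : R) (B : set R) : \bar R :=
  if s == 0 then dirac m B else normal_prob m s B.

(* The pair (Re X, Im X) is a (possibly degenerate) Gaussian vector: every
   real linear combination of its coordinates has a Gaussian law. *)
Definition complex_gaussian (X : Omega -> R[i]) : Prop :=
  complex_rv X /\
  forall u v : R, exists m s : R, forall B : set R, measurable B ->
    P [set w | B (u * cRe (X w) + v * cIm (X w))] = gaussian_law m s B.

(* R[i] carries the Borel sigma-algebra of R * R. *)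
Definition mutually_independent (I : eqType) (X : I -> Omega -> R[i]) : Prop :=
  forall (J : seq I) (B : I -> set (R * R)),
    uniq J -> (forall i, measurable (B i)) ->
    P (\bigcap_(i in [set` J]) [set w | B i (cRe (X i w), cIm (X i w))]) =
    (\prod_(i <- J) P [set w | B i (cRe (X i w), cIm (X i w))])%E.

End complex_random_variables.

Section eigenvalues.
Context {C : closedFieldType} {n : nat}.

Definition eigenvalues (M : 'M[C]_n) : seq C :=
  sval (closed_field_poly_normal (char_poly M)).

Lemma char_poly_eigenvalues (M : 'M[C]_n) :
  char_poly M = \prod_(z <- eigenvalues M) ('X - z%:P).
Proof.
rewrite /eigenvalues; case: closed_field_poly_normal => r /= {1}->.
by rewrite (monicP (char_poly_monic M)) scale1r.
Qed.

Lemma size_eigenvalues (M : 'M[C]_n) : size (eigenvalues M) = n.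
Proof.
apply: succn_inj.
rewrite -(size_char_poly M) [in RHS]char_poly_eigenvalues.
by rewrite (size_prod_XsubC (eigenvalues M) id).
Qed.

End eigenvalues.

(* Meant for Hermitian M, whose eigenvalues have zero imaginary part. *)
Definition eigencount {R : realType} (n : nat) (M : 'M[R[i]]_n)
    (D : set R) : \bar R :=
  (n%:R^-1 * (count (fun z => cRe z \in D) (eigenvalues M))%:R)%:E.

Section eigencount_measure.
Context {R : realType} (n : nat) (M : 'M[R[i]]_n).

Let eigencountE : eigencount M =
  mscale (n%:R^-1)%:nng
    (msum (fun k => dirac (cRe (nth 0%R (eigenvalues M) k))) n).
Proof.
apply/funext => D; rewrite /eigencount /mscale /msum EFinM; congr (_ * _)%E.
transitivity (\sum_(z <- eigenvalues M) (\d_(cRe z) D : \bar R))%E; last first.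
  by rewrite (big_nth 0) big_mkord size_eigenvalues.
elim: (eigenvalues M) => [|z r IH]; first by rewrite big_nil.
by rewrite big_cons /= -IH natrD EFinD diracE.
Qed.

Let eigencount0 : eigencount M set0 = 0%E.
Proof. by rewrite eigencountE measure0. Qed.

Let eigencount_ge0 D : (0 <= eigencount M D)%E.
Proof. by rewrite eigencountE measure_ge0. Qed.

Let eigencount_sigma_additive : semi_sigma_additive (eigencount M).
Proof. by rewrite eigencountE; exact: measure_semi_sigma_additive. Qed.

HB.instance Definition _ := isMeasure.Build _ _ _ (eigencount M)
  eigencount0 eigencount_ge0 eigencount_sigma_additive.

End eigencount_measure.

(* At x = 0 the integrand takes the junk value 0, on a null set. *)
Definition laguerre_law {R : realType} (a : R) (D : set R) : \bar R :=
  ((4 * pi * a ^+ 2)^-1%:E *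
   \int[lebesgue_measure]_(x in D `&` `[0%R, (8 * a ^+ 2)%R])
     (Num.sqrt ((8 * a ^+ 2 - x) / x))%:E)%E.

Section laguerre_law_measure.
Context {R : realType} (a : R).

Let c_ge0 : 0 <= (4 * pi * a ^+ 2)^-1.
Proof. by rewrite invr_ge0 mulr_ge0 ?sqr_ge0 ?mulr_ge0 ?pi_ge0. Qed.

Let measurable_density (D : set R) :
  measurable_fun D (fun x => (Num.sqrt ((8 * a ^+ 2 - x) / x))%:E).
Proof.
apply: measurable_funTS.
apply/measurable_EFinP; apply: measurableT_comp => /=.
  by apply: continuous_measurable_fun; exact: sqrt_continuous.
apply: measurable_funM; first exact: measurable_funB.
rewrite -(setUv [set 0%R : R]); apply/measurable_funU => //.
  exact: measurableC.
split; first exact: measurable_fun_set1.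
apply: open_continuous_measurable_fun.
  by apply: closed_openC; exact: closed_eq.
by move=> x /set_mem/eqP x0; exact: inv_continuous.
Qed.

Let laguerre_law0 : laguerre_law a set0 = 0%E.
Proof. by rewrite /laguerre_law set0I integral_set0 mule0. Qed.

Let laguerre_law_ge0 D : (0 <= laguerre_law a D)%E.
Proof.
rewrite /laguerre_law mule_ge0 ?lee_fin//; apply: integral_ge0 => x _.
by rewrite lee_fin sqrtr_ge0.
Qed.

Let laguerre_law_sigma_additive : semi_sigma_additive (laguerre_law a).
Proof.
move=> F mF tF mUF; rewrite /laguerre_law setI_bigcupl.
have mFI k : measurable (F k `&` `[0, 8 * a ^+ 2]) by exact: measurableI.
have d_ge0 (x : R) : (0 <= (Num.sqrt ((8 * a ^+ 2 - x) / x))%:E)%E.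
  by rewrite lee_fin sqrtr_ge0.
rewrite ge0_integral_bigcup//=; last first.
- by apply: trivIset_setIr.
- exact: measurable_density.
rewrite -nneseriesZl//; last by move=> k _; exact: integral_ge0.
apply: is_cvg_ereal_nneg_natsum => k _.
by rewrite mule_ge0 ?lee_fin//; exact: integral_ge0.
Qed.

HB.instance Definition _ := isMeasure.Build _ _ _ (laguerre_law a)
  laguerre_law0 laguerre_law_ge0 laguerre_law_sigma_additive.

End laguerre_law_measure.

Definition weak_cvg {R : realType} (mu : {measure set R -> \bar R}^nat)
    (nu : {measure set R -> \bar R}) : Prop :=
  forall f : R -> R, continuous f -> bounded_fun f ->
    (fun n => \int[mu n]_x (f x)%:E)%E @ \oo --> (\int[nu]_x (f x)%:E)%E.

Section laguerre_ensemble.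
Context {R : realType} {Omega : Type}.
Variable A : nat -> nat -> Omega -> R[i].

Definition corner (n : nat) (w : Omega) : 'M[R[i]]_n := \matrix_(j, k) A j k w.

Definition laguerre_mx (n : nat) (w : Omega) : 'M[R[i]]_n :=
  n%:R^-1 *: (corner n w *m (corner n w)^t*).

End laguerre_ensemble.

(* Main.v *)
Require Import Defs.
From HB Require Import structures.
From mathcomp Require Import all_boot all_order all_algebra.
From mathcomp Require Import complex ring lra.
From mathcomp Require Import -(notations) mpoly.
From mathcomp Require Import all_classical all_reals all_analysis.
From mathcomp Require Import measurable_realfun.

(** The spectral measures are compared with the limit law through their
    moments.  Let [c = 2 * a ^+ 2] and let m_k be the k-th moment of the
    spectral measure of the matrix of size n, that is, its normalized trace
    of k-th power.

    Gaussian integration by parts in the entries of the matrix yields, for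
    every product Q of moments, the exact loop equation
      E (m_(k+1) Q) = c * (sum over l <= k of E (m_l m_(k-l) Q)) + rest / n^2,
    where the rest is a combination of expectations of products of moments
    ([loop_equation], [wishart_loop]).  Induction on the total degree shows that
    the expectation of a product of moments is the product of numbers b_k up to
    an error of order n^-2, with b_0 = 1 and b_(k+1) = c * (sum of b_l b_(k-l))
    ([wishart_moment_close]).  Products of one and of two factors give both
    the limit of E m_k and the bound n^-2 on the mean square deviation of m_k
    from b_k.  This bound is summable, so that almost surely all m_k converge
    to b_k ([variance_bound], [ae_cvg0_of_summable]).

    The b_k are the moments of the limit law: integrating the derivative of
    x^(k + 1/2) * (b - x)^(3/2) over the support [[0, b]], with b = 4 * c, gives
    the ratio recursion of the Catalan numbers, which implies the convolution
    recursion above ([mp_momentS], [catalan_convolution]).  As the limit law has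
    compact support, convergence of moments implies weak convergence: continuous
    functions are approximated by polynomials near the support, and a high even
    power controls the rest of the line ([average_cvg]).

    Expectations enter as a linear functional on the polynomials in the real
    and imaginary parts of the entries, which maps a monomial to a product of
    one-dimensional Gaussian moments; integration by parts is then formal
    ([gaussian_functional_stein]).  The functional is the expectation because of
    three facts: the moments of the normal law ([normal_momentS]), the
    factorization of the mixed moments of the two parts of an entry, which follows
    from the laws of their linear combinations ([gaussian_mixed_moment]), and
    the multiplicativity of expectations over independent entries
    ([integral_prod]). *)

Import Order.TTheory GRing.Theory Num.Theory.
Import numFieldNormedType.Exports.

Local Open Scope classical_set_scope.
Local Open Scope ring_scope.
Local Open Scope complex_scope.

Set Implicit Arguments.
Unset Strict Implicit.
Unset Printing Implicit Defensive.

Local Notation cRe := complex.Re.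
Local Notation cIm := complex.Im.

(** * Loop equations for traces of words in two matrices *)

(** The terms, with multiplicities, that arise when a word of degree [k] is
    attached to the derivative of a product of traces of powers with
    exponents [s]: the trace of exponent [p] that is derived merges with the
    word into a trace of exponent [k + p], in [p] ways. *)
Fixpoint merge_terms (k : nat) (s : seq nat) : seq (nat * seq nat) :=
  if s is p :: s' then
    (p, (k + p)%N :: s') :: [seq (q.1, p :: q.2) | q <- merge_terms k s']
  else [::].

Lemma size_merge_terms k s q : q \in merge_terms k s -> size q.2 = size s.
Proof.
elim: s q => //= p s IH q; rewrite inE => /orP[/eqP -> //|/mapP[r rs ->] /=].
by rewrite IH.
Qed.

Lemma sumn_merge_terms k s q :
  q \in merge_terms k s -> sumn q.2 = (k + sumn s)%N.
Proof.
elim: s q => //= p s IH q; rewrite inE => /orP[/eqP -> /=|/mapP[r rs ->] /=].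
  by rewrite addnA.
by rewrite IH// addnCA.
Qed.

Section loop_equation.
Variables (K : comNzRingType) (S : comNzRingType) (n : nat).
Variables (E : {additive S -> K}) (D : 'I_n -> 'I_n -> {additive S -> S}).
Variables (A B : 'M[S]_n) (c : K).
Hypothesis DM : forall i j x y, D i j (x * y) = D i j x * y + x * D i j y.
Hypothesis DA : forall i j k l, D i j (A k l) = 0.
Hypothesis DB : forall i j k l, D i j (B k l) = ((k == j) && (l == i))%:R.
Hypothesis stein : forall i j F, E (A i j * F) = c * E (D i j F).

Let W := A *m B.
Let t k := \tr (W ^+ k).

Lemma map_mxM_derivation i j m p q (X : 'M[S]_(m, p)) (Y : 'M[S]_(p, q)) :
  map_mx (D i j) (X *m Y) =
  map_mx (D i j) X *m Y + X *m map_mx (D i j) Y.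
Proof.
apply/matrixP => k l; rewrite !mxE raddf_sum -big_split /=.
by apply: eq_bigr => x _; rewrite DM !mxE.
Qed.

Let DmxA i j : map_mx (D i j) A = 0.
Proof. by apply/matrixP => k l; rewrite !mxE DA. Qed.

Let DmxB i j : map_mx (D i j) B = delta_mx j i.
Proof. by apply/matrixP => k l; rewrite !mxE DB. Qed.

(** As [D i j] annihilates [A], the Leibniz rule visits each occurrence of
    [B] in the word once, and replaces it by an elementary matrix. *)
Lemma derive_BWn i j k : map_mx (D i j) (B *m W ^+ k) =
  \sum_(l < k.+1) (B *m A) ^+ l *m delta_mx j i *m W ^+ (k - l).
Proof.
elim: k => [|k IH].
  by rewrite big_ord1 expr0 mulmx1 expr0 mul1mx mulmx1 DmxB.
rewrite exprSr -[W ^+ k * W]/(W ^+ k *m W) mulmxA {2}/W mulmxA.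
rewrite map_mxM_derivation map_mxM_derivation DmxA mulmx0 addr0 DmxB IH.
rewrite [RHS]big_ord_recr /= subnn expr0 mulmx1; congr (_ + _).
  rewrite !mulmx_suml; apply: eq_bigr => l _.
  by rewrite subSn -1?ltnS// exprSr -!mulmxA.
congr (_ *m _); rewrite -mulmxA.
elim: k {IH} => [|k IH]; first by rewrite expr0 expr1 mul1mx.
rewrite exprS [in RHS]exprS -IH -[W * _]/(W *m _) /W -[RHS]/(_ *m _).
by rewrite !mulmxA.
Qed.

Let derivation1 i j : D i j 1 = 0.
Proof.
by apply: (addrI (D i j 1)); rewrite addr0 -{3}[1]mulr1 DM mul1r mulr1.
Qed.

Let mulmx_BAn k : A *m (B *m A) ^+ k = W ^+ k *m A.
Proof.
elim: k => [|k IH]; first by rewrite !expr0 mulmx1 mul1mx.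
rewrite exprSr [in RHS]exprSr -[(_ ^+ k * _)]/(_ *m _) mulmxA IH.
by rewrite -[X in _ = X *m _]/(_ *m _) /W !mulmxA.
Qed.

Let trBA k : \tr ((B *m A) ^+ k) = t k.
Proof.
case: k => [|k]; first by rewrite /t !expr0.
rewrite /t exprS -[LHS]/(\tr (_ *m _)) -mulmxA mxtrace_mulC.
by rewrite mulmx_BAn exprSr -mulmxA.
Qed.

Lemma trace_delta (X Y : 'M[S]_n) (i j : 'I_n) :
  (X *m delta_mx j i *m Y) j i = X j j * Y i i.
Proof.
rewrite mxE (bigD1 i)//= mxE (bigD1 j)//= mxE !eqxx mulr1 big1 ?addr0 => [|k kj].
  rewrite big1 ?addr0// => k ki; rewrite mxE big1 ?mul0r// => l _.
  by rewrite mxE (negPf ki) andbF mulr0.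
by rewrite mxE (negPf kj) mulr0.
Qed.

Lemma tr_mul_delta (X Y : 'M[S]_n) (i j : 'I_n) :
  \tr (X *m delta_mx j i *m Y) = (Y *m X) i j.
Proof.
rewrite mxtrace_mulC mulmxA.
rewrite /mxtrace (bigD1 i)//= big1 ?addr0 => [|k ki]; last first.
  rewrite mxE big1// => l _.
  by rewrite !mxE (negPf ki) andbF mulr0.
rewrite mxE (bigD1 j)//= big1 ?addr0 => [|k kj]; last first.
  by rewrite !mxE (negPf kj) mulr0.
by rewrite [delta_mx _ _ _ _]mxE !eqxx mulr1.
Qed.

(** Removing one occurrence of [B] cuts the cyclic word in two, and each
    piece closes up into a trace. *)
Lemma sum_derive_BWn k :
  \sum_i \sum_j D i j ((B *m W ^+ k) j i) = \sum_(l < k.+1) t l * t (k - l).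
Proof.
transitivity (\sum_i \sum_j \sum_(l < k.+1)
    ((B *m A) ^+ l) j j * (W ^+ (k - l)) i i).
  apply: eq_bigr => i _; apply: eq_bigr => j _.
  have := congr1 (fun M : 'M[S]_n => M j i) (derive_BWn i j k).
  rewrite mxE => ->; rewrite summxE; apply: eq_bigr => l _.
  by rewrite trace_delta.
under eq_bigr do rewrite exchange_big.
rewrite exchange_big; apply: eq_bigr => l _ /=.
rewrite -(trBA l) /t /mxtrace mulr_sumr; apply: eq_bigr => i _.
by rewrite mulr_suml.
Qed.

(** By cyclicity of the trace, all [p] occurrences of [B] contribute
    equally. *)
Lemma derive_trace i j p : D i j (t p) = (W ^+ p.-1 *m A) i j *+ p.
Proof.
rewrite /t; case: p => [|p].
  rewrite mulr0n expr0 mxtrace1.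
  by rewrite raddfMn /= derivation1 mul0rn.
have -> : D i j (\tr (W ^+ p.+1)) = \tr (map_mx (D i j) (W ^+ p.+1)).
  by rewrite raddf_sum /=; apply: eq_bigr => k _; rewrite !mxE.
rewrite exprS -[W * _]/(W *m _) {1}/W -mulmxA map_mxM_derivation DmxA mul0mx.
rewrite add0r derive_BWn mulmx_sumr raddf_sum /=.
rewrite (eq_bigr (fun=> (W ^+ p *m A) i j)) ?sumr_const ?card_ord// => l _.
rewrite 2!mulmxA tr_mul_delta; congr (_ _ _).
rewrite mulmx_BAn mulmxA -[_ *m W ^+ l]/(_ * _) -exprD subnK// -ltnS; exact: ltn_ord.
Qed.

(** Deriving a trace opens its cyclic word at one occurrence of [B]; the sum
    over [i] and [j] joins the open word to [B *m W ^+ k]. *)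
Lemma sum_derive_prod k s :
  \sum_i \sum_j (B *m W ^+ k) j i * D i j (\prod_(p <- s) t p) =
  \sum_(q <- merge_terms k s) (\prod_(p <- q.2) t p) *+ q.1.
Proof.
elim: s => [|p s IH].
  rewrite /= [RHS]big_nil big1// => i _; rewrite big1// => j _; rewrite big_nil.
  by rewrite derivation1 mulr0.
rewrite /= [RHS]big_cons big_map /=.
under eq_bigr do under eq_bigr do rewrite big_cons DM mulrDr.
under eq_bigr do rewrite big_split.
rewrite big_split /=; congr (_ + _); last first.
  under [RHS]eq_bigr do rewrite big_cons -mulrnAr.
  rewrite -mulr_sumr -IH mulr_sumr; apply: eq_bigr => i _.
  by rewrite mulr_sumr; apply: eq_bigr => j _; rewrite mulrCA.
rewrite big_cons -mulrnAl.
under eq_bigr do under eq_bigr do rewrite derive_trace mulrA mulrnAr.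
under eq_bigr do rewrite -mulr_suml sumrMnl.
rewrite -mulr_suml sumrMnl; congr (_ * _).
case: p => [|p]; first by rewrite !mulr0n.
congr (_ *+ _) => /=.
rewrite exchange_big /= /t.
transitivity (\tr ((B *m W ^+ k) *m (W ^+ p *m A))).
  by rewrite /mxtrace; apply: eq_bigr => j _; rewrite mxE.
rewrite mulmxA mxtrace_mulC -[B *m _ *m _]mulmxA (mulmxA A B) -[A *m B]/W.
by rewrite -[W *m _]/(W * (W ^+ k * W ^+ p)) -exprD -exprS addnS.
Qed.

(** The first letter [A i j] of the leading trace is integrated by parts:
    the derivative acts either on the rest of the same word or on one of the
    other traces. *)
Lemma loop_equation k s :
  E (t k.+1 * \prod_(p <- s) t p) =
  c * (\sum_(l < k.+1) E (t l * t (k - l) * \prod_(p <- s) t p)) +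
  c * \sum_(q <- merge_terms k s) E (\prod_(p <- q.2) t p) *+ q.1.
Proof.
have -> : t k.+1 = \sum_i \sum_j A i j * (B *m W ^+ k) j i.
  rewrite /t exprS -[W * _]/(W *m _) {1}/W -mulmxA /mxtrace.
  by apply: eq_bigr => i _; rewrite mxE.
rewrite mulr_suml raddf_sum /=.
under eq_bigr do rewrite mulr_suml raddf_sum /=.
under eq_bigr do under eq_bigr do
  rewrite -mulrA stein DM raddfD mulrDr.
under eq_bigr do rewrite big_split.
rewrite big_split /=; congr (_ + _).
  under eq_bigr do rewrite -mulr_sumr.
  rewrite -mulr_sumr; congr (_ * _).
  transitivity (E (\sum_i \sum_j (D i j ((B *m W ^+ k) j i) *
      \prod_(p <- s) t p))).
    by rewrite raddf_sum; apply: eq_bigr => i _; rewrite raddf_sum.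
  rewrite -[RHS]raddf_sum; congr (E _).
  rewrite -[RHS]mulr_suml -sum_derive_BWn mulr_suml.
  by apply: eq_bigr => i _; rewrite mulr_suml.
under eq_bigr do rewrite -mulr_sumr.
rewrite -mulr_sumr; congr (_ * _).
transitivity (E (\sum_i \sum_j ((B *m W ^+ k) j i *
      D i j (\prod_(p <- s) t p)))).
  by rewrite raddf_sum; apply: eq_bigr => i _; rewrite raddf_sum.
rewrite sum_derive_prod raddf_sum; apply: eq_bigr => q _.
by rewrite raddfMn.
Qed.

End loop_equation.

(** * Solution of the loop equations up to an error of order [n ^- 2] *)

Section moment_asymptotics.
Variables (K : numFieldType) (e : nat -> seq nat -> K) (b : nat -> K) (c : K).
Hypothesis e_nil : forall n, e n [::] = 1.
Hypothesis e_0 : forall n s, e n (0%N :: s) = e n s.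
Hypothesis e_S : forall n k s, e n (k.+1 :: s) =
  c * (\sum_(l < k.+1) e n [:: (l : nat), (k - l)%N & s]) +
  c / n.+1%:R ^+ 2 * \sum_(q <- merge_terms k s) e n q.2 *+ q.1.
Hypothesis b_0 : b 0 = 1.
Hypothesis b_S : forall k, b k.+1 = c * \sum_(l < k.+1) b l * b (k - l).

Let close (f : nat -> K) (x : K) :=
  exists2 M, 0 <= M & forall n, `|f n - x| <= M / n.+1%:R ^+ 2.

Let inv_ge0 n : 0 <= (n.+1%:R ^+ 2)^-1 :> K.
Proof. by rewrite invr_ge0 exprn_ge0. Qed.

Let closeZ f x y : close f x -> close (fun n => y * f n) (y * x).
Proof.
move=> [M M0 fM]; exists (`|y| * M); rewrite ?mulr_ge0// => n.
by rewrite -mulrBr normrM -mulrA ler_wpM2l.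
Qed.

Let closeD f g x y : close f x -> close g y -> close (fun n => f n + g n) (x + y).
Proof.
move=> [M M0 fM] [N N0 gN]; exists (M + N); rewrite ?addr_ge0// => n.
by rewrite opprD addrACA mulrDl (le_trans (ler_normD _ _))// lerD.
Qed.

Let close_sum (I : Type) (r : seq I) (f : I -> nat -> K) x :
  (forall i, close (f i) (x i)) ->
  close (fun n => \sum_(i <- r) f i n) (\sum_(i <- r) x i).
Proof.
move=> fx; elim: r => [|i r IH].
  by exists 0 => // n; rewrite !big_nil subrr normr0 mul0r.
rewrite big_cons; under [X in close X]funext do rewrite big_cons.
exact: closeD.
Qed.

Let close_small f x : close f x -> close (fun n => c / n.+1%:R ^+ 2 * f n) 0.
Proof.
move=> [M M0 fM]; exists (`|c| * (M + `|x|)) => [|n].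
  by rewrite mulr_ge0 ?addr_ge0.
rewrite subr0 !normrM (ger0_norm (inv_ge0 _)) mulrAC ler_wpM2r// ler_wpM2l//.
rewrite -[f n](subrK x) (le_trans (ler_normD _ _))// lerD2r.
rewrite (le_trans (fM n))// ler_piMr// invf_le1 ?exprn_gt0//.
by rewrite exprn_ege1// ler1n.
Qed.

(** By induction on the total degree: [e_S] expresses a mixed moment through
    mixed moments of total degree smaller by one, and only the sum with the
    small coefficient involves anything else than the recursion for [b]. *)
Lemma mixed_moment_close s : exists2 M, 0 <= M &
  forall n, `|e n s - \prod_(k <- s) b k| <= M / n.+1%:R ^+ 2.
Proof.
suff H N : forall s, (sumn s < N)%N -> close (e^~ s) (\prod_(k <- s) b k).
  exact: (H (sumn s).+1).
elim: N => // N IH {}s; elim: s => [|[|k] s IHs] /= sN.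
- by exists 0 => // n; rewrite big_nil e_nil subrr normr0 mul0r.
- rewrite big_cons b_0 mul1r.
  by under [X in close X]funext do rewrite e_0; exact: IHs.
under [X in close X]funext do rewrite e_S.
rewrite big_cons b_S -[X in close _ X]addr0; apply: closeD.
  rewrite -mulrA; apply: closeZ; rewrite mulr_suml; apply: close_sum => l.
  rewrite (_ : _ * _ = \prod_(j <- [:: (l : nat), (k - l)%N & s]) b j).
    apply: IH; rewrite /= addnA subnKC; last by rewrite -ltnS.
    by rewrite -ltnS -addSn.
  by rewrite !big_cons mulrA.
pose x := \sum_(q <- merge_terms k s) (\prod_(j <- q.2) b j) *+ q.1.
apply: (@close_small _ x).
suff H : forall r : seq (nat * seq nat), {subset r <= merge_terms k s} ->
    close (fun n => \sum_(q <- r) e n q.2 *+ q.1)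
      (\sum_(q <- r) (\prod_(j <- q.2) b j) *+ q.1) by exact: H.
elim=> [|q r IHr] rs.
  by exists 0 => // n; rewrite !big_nil subrr normr0 mul0r.
rewrite big_cons; under [X in close X]funext do rewrite big_cons.
apply: closeD; last by apply: IHr => y yr; apply: rs; rewrite inE yr orbT.
rewrite -mulr_natl; under [X in close X]funext do rewrite -mulr_natl.
apply/closeZ/IH; rewrite (@sumn_merge_terms k s)// ?rs ?mem_head//.
Qed.

End moment_asymptotics.

(** * Gaussian expectation of polynomials in the matrix entries *)

Section gaussian_functional.
Variables (K : comNzRingType) (N : nat) (g : nat -> K) (v : K).
Hypothesis g1 : g 1 = 0.
Hypothesis gS : forall k, g k.+2 = v * k.+1%:R * g k.

Local Notation poly := (mpoly.mpoly N K).

(** The expectation of a polynomial in independent variables with common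
    moments [g]. *)
Definition gaussian_functional (p : poly) : K :=
  \sum_(m <- mpoly.msupp p) mpoly.mcoeff m p * \prod_i g (mpoly.fun_of_multinom m i).


Local Notation wt m := (\prod_i g (mpoly.fun_of_multinom m i)).

Lemma gaussian_functional_sub (r : seq (mpoly.multinom N)) (p : poly) : uniq r -> {subset mpoly.msupp p <= r} ->
  gaussian_functional p = \sum_(m <- r) mpoly.mcoeff m p * wt m.
Proof.
move=> r_uniq pr; rewrite [RHS](bigID (mem (mpoly.msupp p)))/=.
rewrite [X in _ + X]big1 ?addr0 => [|m /mpoly.memN_msupp_eq0 ->]; last first.
  by rewrite mul0r.
rewrite -big_filter; apply: perm_big; apply: uniq_perm.
- exact: mpoly.msupp_uniq.
- exact: filter_uniq.
by move=> m; rewrite mem_filter; case: (boolP (m \in _)) => //= /pr ->.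
Qed.

Lemma gaussian_functional_is_linear : linear_for *%R gaussian_functional.
Proof.
move=> a p q.
pose r := undup (mpoly.msupp (a *: p + q) ++ mpoly.msupp p ++ mpoly.msupp q).
have ru : uniq r by exact: undup_uniq.
rewrite !(@gaussian_functional_sub r)//; last first.
- by move=> m mp; rewrite mem_undup !mem_cat mp ?orbT.
- by move=> m mp; rewrite mem_undup !mem_cat mp ?orbT.
- by move=> m mp; rewrite mem_undup !mem_cat mp ?orbT.
rewrite mulr_sumr -big_split/=; apply: eq_bigr => m _.
by rewrite mpoly.mcoeffD mpoly.mcoeffZ mulrDl mulrA.
Qed.

HB.instance Definition _ := GRing.isLinear.Build K poly K *%R
  gaussian_functional gaussian_functional_is_linear.

Lemma gaussian_functionalX m : gaussian_functional (mpoly.mpolyX K m) = wt m.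
Proof.
by rewrite /gaussian_functional mpoly.msuppX big_seq1 mpoly.mcoeffX eqxx mul1r.
Qed.

(** Gaussian integration by parts: on a monomial this is the recursion [gS]
    for the exponent of the variable [i]. *)
Lemma gaussian_functional_stein i (p : poly) :
  gaussian_functional (mpoly.mpolyX K (mpoly.mnm1 i) * p) =
  v * gaussian_functional (mpoly.mderiv i p).
Proof.
suff H (r : seq (mpoly.multinom N)) (f : mpoly.multinom N -> K) :
    gaussian_functional (mpoly.mpolyX K (mpoly.mnm1 i) *
      \sum_(m <- r) f m *: mpoly.mpolyX K m) =
    v * gaussian_functional (mpoly.mderiv i
      (\sum_(m <- r) f m *: mpoly.mpolyX K m)).
  by rewrite [p]mpoly.mpolyE.
rewrite mulr_sumr (raddf_sum (mpoly.mderiv i)) !(raddf_sum gaussian_functional) mulr_sumr/=.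
apply: eq_bigr => m _.
rewrite -scalerAr mpoly.mderivZ !linearZ/= mulrCA; congr (_ * _).
rewrite -mpoly.mpolyXD mpoly.mderivX linearZ/= !gaussian_functionalX.
rewrite (bigD1 i)//= [in RHS](bigD1 i)//=.
rewrite mpoly.mnmDE mpoly.mnmBE mpoly.mnm1E eqxx add1n.
rewrite (eq_bigr (fun j => g (mpoly.fun_of_multinom m j))); last first.
  by move=> j ji; rewrite mpoly.mnmDE mpoly.mnm1E eq_sym (negPf ji) add0n.
rewrite [in RHS](eq_bigr (fun j => g (mpoly.fun_of_multinom m j))); last first.
  by move=> j ji; rewrite mpoly.mnmBE mpoly.mnm1E eq_sym (negPf ji) subn0.
rewrite !mulrA; congr (_ * _).
case: (mpoly.fun_of_multinom m i) => [|k]; first by rewrite g1 mulr0 mul0r.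
by rewrite gS subn1.
Qed.

End gaussian_functional.

Section ginibre.
Variables (K : numFieldType) (im : K) (n : nat).
Hypothesis im2 : im * im = -1.

(** The boolean tells the real part ([false]) of an entry from its imaginary
    part ([true]). *)
Definition entry_index := ('I_n * 'I_n * bool)%type.
Definition entry_poly := mpoly.mpoly #|{: entry_index}| K.

Definition entry_var (t : entry_index) : entry_poly := mpoly.mpolyX K (mpoly.mnm1 (enum_rank t)).

Definition ginibre : 'M[entry_poly]_n :=
  \matrix_(j, k) (entry_var (j, k, false) + im *: entry_var (j, k, true)).
Definition ginibre_adj : 'M[entry_poly]_n :=
  \matrix_(k, j) (entry_var (j, k, false) - im *: entry_var (j, k, true)).

Definition entry_deriv (t : entry_index) (p : entry_poly) : entry_poly := mpoly.mderiv (enum_rank t) p.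

(** The Wirtinger derivative with respect to the conjugate of the entry [(j,
    k)]. *)
Definition dbar (j k : 'I_n) (p : entry_poly) : entry_poly :=
  2^-1 *: (entry_deriv (j, k, false) p + im *: entry_deriv (j, k, true) p).

Lemma entry_deriv_var t u : entry_deriv t (entry_var u) = (t == u)%:R.
Proof.
rewrite /entry_deriv /entry_var mpoly.mderivX mpoly.mnm1E.
rewrite (inj_eq enum_rank_inj) eq_sym; have [->|_] := eqVneq t u; last first.
  by rewrite scale0r.
rewrite scale1r -[RHS]mpoly.mpolyX0; congr (mpoly.mpolyX _ _).
by apply/mpoly.mnmP => i; rewrite mpoly.mnmBE mpoly.mnm0E subnn.
Qed.

Lemma dbar_is_additive j k : nmod_morphism (dbar j k).
Proof.
split=> [|p q]; rewrite /dbar /entry_deriv.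
  by rewrite !(raddf0 (mpoly.mderiv _)) scaler0 addr0 scaler0.
by rewrite !(raddfD (mpoly.mderiv _)) -[RHS]scalerDr [im *: (_ + _)]scalerDr addrACA.
Qed.
HB.instance Definition _ j k :=
  GRing.isNmodMorphism.Build entry_poly entry_poly (dbar j k) (dbar_is_additive j k).

Lemma dbarM j k p q : dbar j k (p * q) = dbar j k p * q + p * dbar j k q.
Proof.
rewrite /dbar /entry_deriv !mpoly.mderivM -scalerAl -scalerAr -scalerDr; congr (_ *: _).
rewrite scalerDr addrACA mulrDl mulrDr; congr (_ + _ + (_ + _)).
  by rewrite scalerAl.
by rewrite scalerAr.
Qed.

Let entry_derivZ t c p : entry_deriv t (c *: p) = c *: entry_deriv t p.
Proof. exact: mpoly.mderivZ. Qed.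
Let entry_derivD t p q : entry_deriv t (p + q) = entry_deriv t p + entry_deriv t q.
Proof. exact: (raddfD (mpoly.mderiv _)). Qed.
Let entry_derivB t p q : entry_deriv t (p - q) = entry_deriv t p - entry_deriv t q.
Proof. exact: (raddfB (mpoly.mderiv _)). Qed.

Lemma dbar_ginibre i j k l : dbar i j (ginibre k l) = 0.
Proof.
rewrite mxE /dbar !entry_derivD !entry_derivZ !entry_deriv_var !xpair_eqE /= !andbT !andbF.
rewrite scaler0 addr0 add0r scalerA im2 scaleN1r subrr scaler0 //.
Qed.

Lemma dbar_ginibre_adj i j k l :
  dbar i j (ginibre_adj k l) = ((k == j) && (l == i))%:R.
Proof.
rewrite mxE /dbar !entry_derivB !entry_derivZ !entry_deriv_var !xpair_eqE /= !andbT !andbF.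
rewrite [in RHS]andbC [in RHS]eq_sym [X in _ && X]eq_sym.
case: (_ && _) => /=; last by rewrite !scaler0 !subr0 scaler0 addr0 scaler0.
rewrite scaler0 subr0 sub0r scalerN scalerA im2 scaleN1r opprK.
by rewrite -[X in _ *: (X + _)]scale1r -[X in _ *: (_ + X)]scale1r -scalerDl
   scalerA mulVf ?scale1r ?pnatr_eq0.
Qed.

Variables (g : nat -> K) (v : K).
Hypothesis g1 : g 1 = 0.
Hypothesis gS : forall k, g k.+2 = v * k.+1%:R * g k.

Definition ginibre_mean : entry_poly -> K := @gaussian_functional K #|{: entry_index}| g.

HB.instance Definition _ := GRing.Linear.copy ginibre_mean (@gaussian_functional K #|{: entry_index}| g).

(** Integrating by parts in the real and in the imaginary part of an entry
    produces the two halves of a Wirtinger derivative. *)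
Lemma stein_ginibre j k (p : entry_poly) :
  ginibre_mean (ginibre j k * p) = 2 * v * ginibre_mean (dbar j k p).
Proof.
rewrite mxE mulrDl -scalerAl raddfD/= linearZ/= /ginibre_mean /entry_var.
rewrite !(gaussian_functional_stein g1 gS) /dbar /entry_deriv.
rewrite linearZ/= raddfD/= linearZ/= [im * _]mulrCA -mulrDr.
by rewrite mulrCA 2!mulrA mulVf ?mul1r ?pnatr_eq0.
Qed.

Definition wishart_trace k : entry_poly := \tr ((ginibre *m ginibre_adj) ^+ k).

Lemma wishart_loop k s :
  ginibre_mean (wishart_trace k.+1 * \prod_(p <- s) wishart_trace p) =
  2 * v * (\sum_(l < k.+1) ginibre_mean (wishart_trace l * wishart_trace (k - l) *
                          \prod_(p <- s) wishart_trace p)) +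
  2 * v * \sum_(q <- merge_terms k s) ginibre_mean (\prod_(p <- q.2) wishart_trace p) *+ q.1.
Proof.
exact: (loop_equation dbarM dbar_ginibre dbar_ginibre_adj stein_ginibre).
Qed.

Lemma wishart_trace0 : wishart_trace 0 = n%:R.
Proof. by rewrite /wishart_trace expr0 mxtrace1. Qed.

End ginibre.

Section ginibre_moments.
Variables (K : numFieldType) (im : K) (g : nat -> K) (v : K) (b : nat -> K).
Hypothesis im2 : im * im = -1.
Hypothesis g0 : g 0 = 1.
Hypothesis g1 : g 1 = 0.
Hypothesis gS : forall k, g k.+2 = v * k.+1%:R * g k.
Hypothesis b_0 : b 0 = 1.
Hypothesis b_S : forall k, b k.+1 = 2 * v * \sum_(l < k.+1) b l * b (k - l).

Definition wishart_moment (n : nat) (s : seq nat) : K :=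
  ginibre_mean g (\prod_(p <- s) wishart_trace im n p) / n%:R ^+ (size s + sumn s).

(** The normalization of [wishart_moment] cancels all powers of [n] in the
    loop equation except for a factor [n ^- 2] in front of the merged
    traces. *)
Lemma wishart_moment_close s : exists2 M, 0 <= M &
  forall n, `|wishart_moment n.+1 s - \prod_(k <- s) b k| <= M / n.+1%:R ^+ 2.
Proof.
have nz n : n.+1%:R != 0 :> K by rewrite pnatr_eq0.
apply: (@mixed_moment_close K (fun n => wishart_moment n.+1) b (2 * v)) => //.
- move=> n; rewrite /wishart_moment big_nil expr0 divr1 /ginibre_mean.
  rewrite -[1]mpoly.mpolyX0 gaussian_functionalX big1// => i _.
  by rewrite mpoly.mnm0E.
- move=> n s'; rewrite /wishart_moment big_cons wishart_trace0 /=.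
  rewrite mulr_natl raddfMn/= -[ginibre_mean _ _ *+ _]mulr_natl addSn exprS add0n.
  by rewrite invfM mulrACA divff// mul1r.
move=> n k s'; rewrite /wishart_moment big_cons (wishart_loop n.+1 im2 g1 gS).
rewrite mulrDl; congr (_ + _).
  rewrite -mulrA; congr (_ * _); rewrite mulr_suml; apply: eq_bigr => l _.
  rewrite !big_cons mulrA; congr (_ / _ ^+ _) => /=.
  by rewrite !(addSn, addnS) (addnA l) subnKC// -ltnS.
rewrite -mulrA -[RHS]mulrA; congr (_ * _).
rewrite mulr_suml mulr_sumr; apply: eq_big_seq => q qs.
rewrite !mulrnAl !mulrnAr mulrCA; congr ((_ * _) *+ _).
rewrite (sumn_merge_terms qs) (size_merge_terms qs) -invfM -exprD/=.
by congr (_ ^+ _)^-1; rewrite !(addSn, addnS) addnCA.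
Qed.

End ginibre_moments.

Section wishart_eval.
Variables (K : numFieldType) (im : K) (n : nat) (x : entry_index n -> K).

Definition entry_poly_eval (p : entry_poly K n) : K :=
  mpoly.meval (fun i => x (enum_val i)) p.

HB.instance Definition _ := GRing.RMorphism.copy entry_poly_eval
  (mpoly.meval (fun i => x (enum_val i))).

Lemma entry_poly_evalZ c p : entry_poly_eval (c *: p) = c * entry_poly_eval p.
Proof. exact: mpoly.mevalZ. Qed.

Lemma entry_poly_evalX t : entry_poly_eval (entry_var K t) = x t.
Proof. by rewrite /entry_poly_eval mpoly.mevalXU enum_rankK. Qed.

Lemma eval_wishart_trace k : entry_poly_eval (wishart_trace im n k) =
  \tr (((\matrix_(i, j) (x (i, j, false) + im * x (i, j, true))) *m
        (\matrix_(i, j) (x (j, i, false) - im * x (j, i, true)))) ^+ k).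
Proof.
rewrite /wishart_trace.
have map_mxX (M : 'M[entry_poly K n]_n) :
    map_mx entry_poly_eval (M ^+ k) = map_mx entry_poly_eval M ^+ k.
  elim: k => [|k IH]; first by rewrite !expr0 map_mx1.
  by rewrite exprS -[M * _]/(M *m _) map_mxM IH exprS.
rewrite -[LHS](trace_map_mx entry_poly_eval) map_mxX map_mxM; congr (\tr ((_ *m _) ^+ k)).
  by apply/matrixP => i j; rewrite !mxE rmorphD/= entry_poly_evalZ !entry_poly_evalX.
by apply/matrixP => i j; rewrite !mxE rmorphB/= entry_poly_evalZ !entry_poly_evalX.
Qed.
End wishart_eval.

(** * Integrals against weighted and pushed-forward measures *)

Section weighted_pushforward.
Local Open Scope ereal_scope.
Context {d d' : measure_display} {T : measurableType d} {T' : measurableType d'}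
  {R : realType}.
Variables (mu : {measure set T -> \bar R}) (nu : {measure set T' -> \bar R}).
Variables (X : T -> T') (Y : T -> R).
Hypotheses (mX : measurable_fun setT X) (mY : measurable_fun setT Y).
Hypothesis Y0 : forall w, (0 <= Y w)%R.
Hypothesis XY : forall B, measurable B -> \int[mu]_(w in X @^-1` B) (Y w)%:E = nu B.

Import HBNNSimple.

Let integral_nnsfun (f : {nnsfun T' >-> R}) :
  \int[mu]_w ((f (X w))%:E * (Y w)%:E) = \int[nu]_x (f x)%:E.
Proof.
have mXr r : measurable (X @^-1` (f @^-1` [set r])).
  by rewrite -[X in measurable X]setTI; exact: mX.
have mfX : measurable_fun setT (f \o X) by exact: measurableT_comp.
under [RHS]eq_integral do rewrite fimfunE -fsumEFin//.
rewrite ge0_integral_fsum//; last 2 first.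
- by move=> r; exact/measurable_EFinP/measurableT_comp.
- by move=> r x _; rewrite EFinM nnfun_muleindic_ge0.
transitivity (\int[mu]_w (\sum_(r \in range f)
    (r * \1_(f @^-1` [set r]) (X w))%:E * (Y w)%:E)).
  apply: eq_integral => w _.
  rewrite -(@ge0_mule_fsuml _ _ _
      (fun r => (r * \1_(f @^-1` [set r]) (X w))%:E)); last first.
    by move=> r; rewrite EFinM nnfun_muleindic_ge0.
  by congr (_ * _); rewrite {1}fimfunE -fsumEFin.
rewrite ge0_integral_fsum//; last 2 first.
- move=> r; apply/measurable_EFinP; apply: measurable_funM => //.
  by apply: measurable_funM => //; apply: measurableT_comp.
- move=> r w _; apply: mule_ge0; last by rewrite lee_fin.
  by rewrite EFinM nnfun_muleindic_ge0.
apply: eq_fsbigr => r /[!inE] -[x _ <-].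
have fx0 : (0 <= f x)%R by [].
under eq_integral do rewrite EFinM -muleA.
rewrite ge0_integralZl//; last 2 first.
- apply/measurable_EFinP; apply: measurable_funM => //.
  by apply: measurableT_comp.
- by move=> w _; rewrite mule_ge0// lee_fin.
under [RHS]eq_integral do rewrite EFinM.
rewrite ge0_integralZl//; last exact/measurable_EFinP.
rewrite integral_indic// setIT -XY//; congr (_ * _).
rewrite [RHS]integral_mkcond; apply: eq_integral => w _.
rewrite patchE indicE; have [xw|xw] := boolP (X w \in _).
  by rewrite mul1e ifT// inE/=; move: xw; rewrite inE.
by rewrite mul0e ifF//; apply: contraNF xw; rewrite !inE.
Qed.

(** An identity between set functions becomes an identity between integrals.
    With [X] the identity it evaluates integrals against a law given by a
    density; with [nu] a multiple of the law of [X] it separates a factor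
    that is independent of [X]. *)
Lemma ge0_integral_weighted_pushforward (f : T' -> \bar R) :
  measurable_fun setT f -> (forall x, 0 <= f x) ->
  \int[mu]_w (f (X w) * (Y w)%:E) = \int[nu]_x f x.
Proof.
move=> mf f0; pose h := nnsfun_approx measurableT mf.
have hcvg x : EFin \o h ^~ x @ \oo --> f x by exact: cvg_nnsfun_approx.
have hnd x : nondecreasing_seq (EFin \o h ^~ x).
  by move=> a b ab; rewrite lee_fin; exact/lefP/nd_nnsfun_approx.
transitivity (limn (fun n => \int[nu]_x (h n x)%:E)); last first.
  rewrite -monotone_convergence//.
  - by apply: eq_integral => x _; apply/cvg_lim => //; exact: hcvg.
  - by move=> n; exact/measurable_EFinP.
  - by move=> n x _; rewrite lee_fin.
  - by move=> x _; exact: hnd.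
transitivity (limn (fun n => \int[mu]_w ((h n (X w))%:E * (Y w)%:E))); last first.
  by congr (limn _); apply/funext => n; rewrite integral_nnsfun.
rewrite -monotone_convergence//.
- apply: eq_integral => w _; apply/esym/cvg_lim => //.
  by apply: cvgeZr => //; exact: hcvg.
- move=> n; apply/measurable_EFinP; apply: measurable_funM => //.
  exact: measurableT_comp.
- by move=> n w _; rewrite mule_ge0// lee_fin.
- by move=> w _ a b ab; apply: lee_wpmul2r; [rewrite lee_fin|exact: hnd].
Qed.

Lemma integral_weighted_pushforward (f : T' -> R) : measurable_fun setT f ->
  \int[mu]_w (f (X w) * Y w)%:E = \int[nu]_x (f x)%:E.
Proof.
move=> mf; have mEf : measurable_fun setT (EFin \o f) by exact/measurable_EFinP.
rewrite [RHS]integralE [LHS]integralE; congr (_ - _).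
- rewrite -(@ge0_integral_weighted_pushforward (EFin \o f)^\+)//; last first.
    exact: measurable_funepos.
  by apply: eq_integral => w _; rewrite !funeposE maxe_pMl ?lee_fin// mul0e.
- rewrite -(@ge0_integral_weighted_pushforward (EFin \o f)^\-)//; last first.
    exact: measurable_funeneg.
  by apply: eq_integral => w _; rewrite !funenegE maxe_pMl ?lee_fin// mul0e mulNe.
Qed.

Lemma integrable_weighted_pushforward (f : T' -> R) : measurable_fun setT f ->
  mu.-integrable setT (fun w => (f (X w) * Y w)%:E) ->
  nu.-integrable setT (EFin \o f).
Proof.
move=> mf /integrableP[_ fi]; apply/integrableP; split.
  exact/measurable_EFinP.
rewrite (le_lt_trans _ fi)// -(@ge0_integral_weighted_pushforward (abse \o EFin \o f))//.
  rewrite le_eqVlt; apply/predU1P; left; apply: eq_integral => w _.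
  by rewrite /= normrM (ger0_norm (Y0 w)) EFinM.
  by apply: measurableT_comp => //; exact/measurable_EFinP.
by move=> x; rewrite /= lee_fin.
Qed.

End weighted_pushforward.

Section exhaustion.
Context {R : realType}.
Notation mu := lebesgue_measure.

(** Allows the fundamental theorem of calculus to be applied on smaller
    intervals, away from infinity or from a singularity. *)
Lemma integral_exhaust (f : R -> R) (I : nat -> set R) :
  mu.-integrable setT (EFin \o f) -> (forall n, measurable (I n)) ->
  (forall x, f x != 0 -> \forall n \near \oo, I n x) ->
  (\int[mu]_(x in I n) (f x)%:E @[n --> \oo] --> \int[mu]_x (f x)%:E)%E.
Proof.
move=> fi mI fI; pose g n : R -> \bar R := (EFin \o f) \_ (I n).
have mf : measurable_fun setT (EFin \o f) by exact: measurable_int fi.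
have mg n : measurable_fun setT (g n).
  apply/(measurable_restrictT _ (mI n)); exact: measurable_funTS.
have gf : {ae mu, forall x, setT x -> g ^~ x @ \oo --> (EFin \o f) x}.
  apply: aeW => x _; have [fx0|fx0] := eqVneq (f x) 0.
    rewrite (_ : g ^~ x = fun=> 0%E) /= ?fx0; first exact: cvg_cst.
    by apply/funext => n; rewrite /g patchE /= fx0; case: ifP.
  apply: cvg_near_cst; near=> n.
  rewrite /g patchE ifT// inE; near: n; exact: fI.
have ig : mu.-integrable setT (abse \o EFin \o f) by exact: integrable_abse fi.
have fg : {ae mu, forall x n, setT x -> (`|g n x| <= (abse \o EFin \o f) x)%E}.
  apply: aeW => x n _; rewrite /g patchE; case: ifPn => // _.
  by rewrite abse0 abse_ge0.
have [_ _] := @dominated_convergence _ _ _ mu setT measurableT g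
  (EFin \o f) (abse \o EFin \o f) mg mf gf ig fg.
by under eq_fun do rewrite -integral_mkcond.
Unshelve. all: by end_near. Qed.

End exhaustion.

(** * Products of functions of independent variables *)

Section independent_product.
Context {d d' : measure_display} {T : measurableType d} {T' : measurableType d'}
  {R : realType} (P : probability T R) {I : choiceType}.
Variable Z : I -> T -> T'.
Hypothesis mZ : forall i, measurable_fun setT (Z i).
Hypothesis indepZ : forall (J : seq I) (B : I -> set T'),
  uniq J -> (forall i, measurable (B i)) ->
  P (\bigcap_(i in [set` J]) [set w | B i (Z i w)]) =
  (\prod_(i <- J) P [set w | B i (Z i w)])%E.

Definition law_mean (f : T' -> R) i : R := fine (\int[P]_w (f (Z i w))%:E).

Definition law_integrable (f : T' -> R) i :=
  measurable_fun setT f /\ P.-integrable setT (fun w => (f (Z i w))%:E).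

Let meanE f i : law_integrable f i -> (\int[P]_w (f (Z i w))%:E)%E = (law_mean f i)%:E.
Proof. by move=> [_ fi]; rewrite /law_mean fineK// integrable_fin_num. Qed.

Let measurable_comp f i : law_integrable f i -> measurable_fun setT (fun w => f (Z i w)).
Proof. by move=> [mf _]; exact: measurableT_comp. Qed.

Let measurable_prod_comp (f : I -> T' -> R) (J : seq I) :
  (forall i, law_integrable (f i) i) ->
  measurable_fun setT (fun w => \prod_(i <- J) f i (Z i w)).
Proof.
move=> fok; apply: measurable_prod => i _; exact: measurable_comp.
Qed.

Let indic_preimage (B : set T') i w : \1_(Z i @^-1` B) w = \1_B (Z i w) :> R.
Proof. by rewrite !indicE; congr (nat_of_bool _)%:R; apply/idP/idP; rewrite !inE. Qed.

Let indic_ok (B : set T') i : measurable B -> law_integrable \1_B i.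
Proof.
move=> mB; split; first exact: measurable_indic.
rewrite (_ : (fun _ => _) = EFin \o \1_(Z i @^-1` B)).
  apply: integrable_indic => //.
    by rewrite -[X in measurable X]setTI; exact: mZ.
by apply/funext => w; rewrite /= indic_preimage.
Qed.

Let mean_indic (B : set T') i : measurable B ->
  ((law_mean \1_B i)%:E = P [set w | B (Z i w)])%E.
Proof.
move=> mB; rewrite -meanE; last exact: indic_ok.
rewrite (_ : (fun _ => _) = EFin \o \1_(Z i @^-1` B)).
  rewrite integral_indic// ?setIT//.
  by rewrite -[X in measurable X]setTI; exact: mZ.
by apply/funext => w; rewrite /= indic_preimage.
Qed.

(** Independence is the case of indicators, and a factor at a time is
    replaced by a function: the factors indexed by [J] have been replaced,
    and the freedom to choose the set of one further factor identifies the
    law of that factor weighted by the others. *)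
Let integral_prod_ge0_indic (f : I -> T' -> R) (J J2 : seq I) (B : I -> set T') :
  (forall i, law_integrable (f i) i) -> (forall i x, 0 <= f i x) ->
  (forall i, measurable (B i)) ->
  uniq (J ++ J2) ->
  (\int[P]_w (\prod_(i <- J) f i (Z i w) * \prod_(i <- J2) \1_(B i) (Z i w))%:E =
   (\prod_(i <- J) law_mean (f i) i * \prod_(i <- J2) law_mean \1_(B i) i)%:E)%E.
Proof.
move=> fok f0; elim: J J2 B => [|j J IH] J2 B mB /=.
  move=> uJ; under eq_integral do rewrite big_nil mul1r.
  rewrite big_nil mul1r.
  have mBZ i : measurable [set w | B i (Z i w)].
    by rewrite -[X in measurable X]setTI; exact: mZ.
  have := indepZ uJ mB.
  rewrite (eq_bigr (fun i => (law_mean \1_(B i) i)%:E)); last first.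
    by move=> i _; rewrite mean_indic.
  rewrite prodEFin => <-; rewrite -[in RHS](setIT (bigcap _ _)) -integral_indic//; last first.
    by apply: fin_bigcap_measurable => //; exact: finite_seq.
  apply: eq_integral => w _; congr (_%:E).
  elim: J2 uJ => [|i J2 IHJ] /=.
    by rewrite big_nil set_nil bigcap_set0 indicT.
  move=> /andP[_ /IHJ IHu]; rewrite big_cons IHu.
  have -> : [set` i :: J2] = i |` [set` J2].
    apply/seteqP; split=> k /=; rewrite inE.
      by move=> /orP[/eqP ->|kJ]; [left|right].
    by move=> [->|->]; rewrite ?eqxx ?orbT.
  rewrite bigcap_setU1 indicI.
  by congr (_ * _); rewrite -indic_preimage.
move=> /andP[jJ uJ].
pose Y w := \prod_(i <- J) f i (Z i w) * \prod_(i <- J2) \1_(B i) (Z i w).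
pose q := \prod_(i <- J) law_mean (f i) i * \prod_(i <- J2) law_mean \1_(B i) i.
have mean0 g i : law_integrable g i -> (forall x, 0 <= g x) -> 0 <= law_mean g i.
  by move=> gok g0; rewrite -lee_fin -meanE//; apply: integral_ge0 => w _; rewrite lee_fin.
have q0 : 0 <= q.
  by apply: mulr_ge0; apply: prodr_ge0 => i _; apply: mean0 => //; exact: indic_ok.
have Y0 w : 0 <= Y w by rewrite mulr_ge0 ?prodr_ge0.
have mY : measurable_fun setT Y.
  apply: measurable_funM; first exact: measurable_prod_comp.
  by apply: (@measurable_prod_comp (fun i => \1_(B i))) => i; exact: indic_ok.
pose law : {measure set T' -> \bar R} :=
  measure_function_pushforward__canonical__measure_function_Measure P (mZ j).
pose nu : {measure set T' -> \bar R} := mscale (NngNum q0) law.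
have XY C : measurable C -> (\int[P]_(w in Z j @^-1` C) (Y w)%:E = nu C)%E.
  move=> mC; pose B' i := if i == j then C else B i.
  have mB' i : measurable (B' i) by rewrite /B'; case: ifP.
  have uJ2 : uniq (J ++ (j :: J2)).
    by rewrite -[_ ++ _]/(J ++ [:: j] ++ J2) uniq_catCA /= jJ.
  have B'E i : i \in J2 -> B' i = B i.
    rewrite /B'; case: eqVneq => // -> jJ2.
    by move: jJ; rewrite mem_cat jJ2 orbT.
  have := IH _ _ mB' uJ2; rewrite !big_cons {2}/B' eqxx.
  rewrite [X in _ * (_ * X)](_ : _ = \prod_(i <- J2) law_mean \1_(B i) i); last first.
    by apply: eq_big_seq => i /B'E ->.
  rewrite mulrCA EFinM mean_indic// muleC => H.
  rewrite /nu /mscale/= /pushforward -[RHS]H.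
  rewrite integral_mkcond; apply: eq_integral => w _.
  rewrite patchE big_cons {1}/B' eqxx.
  rewrite [X in _ * (_ * X)](_ : _ = \prod_(i <- J2) \1_(B i) (Z i w)); last first.
    by apply: eq_big_seq => i /B'E ->.
  rewrite mulrCA -indic_preimage indicE.
  by case: (w \in _); rewrite ?mul1r// mul0r.
have [mfj _] := fok j.
transitivity (\int[P]_w ((EFin \o f j) (Z j w) * (Y w)%:E))%E.
  by apply: eq_integral => w _; rewrite /= -EFinM big_cons mulrA.
rewrite (@ge0_integral_weighted_pushforward _ _ _ _ _ P nu)//; last 2 first.
- exact/measurable_EFinP.
- by move=> x; rewrite lee_fin.
rewrite ge0_integral_mscale//=; last 2 first.
- exact/measurable_EFinP.
- by move=> x _; rewrite lee_fin.
rewrite ge0_integral_pushforward//=; last 2 first.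
- exact/measurable_EFinP.
- by move=> x _; rewrite lee_fin.
by rewrite preimage_setT meanE// -EFinM big_cons -mulrA mulrC.
Qed.

Lemma integral_prod_ge0 (f : I -> T' -> R) (J : seq I) :
  (forall i, law_integrable (f i) i) -> (forall i x, 0 <= f i x) -> uniq J ->
  (\int[P]_w (\prod_(i <- J) f i (Z i w))%:E = (\prod_(i <- J) law_mean (f i) i)%:E)%E.
Proof.
move=> fok f0 uJ.
have := @integral_prod_ge0_indic f J [::] (fun=> setT) fok f0 (fun=> measurableT).
rewrite cats0 => /(_ uJ); rewrite big_nil mulr1 => <-.
by apply: eq_integral => w _; rewrite big_nil mulr1.
Qed.

Lemma integrable_prod (f : I -> T' -> R) (J : seq I) :
  (forall i, law_integrable (f i) i) -> uniq J ->
  P.-integrable setT (fun w => (\prod_(i <- J) f i (Z i w))%:E).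
Proof.
move=> fok uJ; apply/integrableP; split.
  exact/measurable_EFinP/measurable_prod_comp.
under eq_integral do rewrite /= normr_prod.
rewrite (@integral_prod_ge0 (fun i x => `|f i x|))// ?ltry// => i.
have [mf fi] := fok i; split; first exact: measurableT_comp.
by move/integrable_norm : fi.
Qed.

Lemma integral_prod (f : I -> T' -> R) (J : seq I) :
  (forall i, law_integrable (f i) i) -> uniq J ->
  (\int[P]_w (\prod_(i <- J) f i (Z i w))%:E = (\prod_(i <- J) law_mean (f i) i)%:E)%E.
Proof.
move=> fok uJ.
(* signed factors are split into nonnegative ones one index of [J1] at a time *)
suff H J1 J2 (h : I -> T' -> R) : (forall i, law_integrable (h i) i) ->
    (forall i, i \notin J1 -> forall x, 0 <= h i x) -> uniq (J1 ++ J2) ->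
    (\int[P]_w (\prod_(i <- J1 ++ J2) h i (Z i w))%:E =
    (\prod_(i <- J1 ++ J2) law_mean (h i) i)%:E)%E.
  pose h i := if i \in J then f i else cst 0.
  have := H J [::] h; rewrite cats0 => Hh.
  rewrite (_ : \prod_(i <- J) law_mean (f i) i = \prod_(i <- J) law_mean (h i) i); last first.
    by apply: eq_big_seq => i iJ; rewrite /h iJ.
  rewrite -Hh//.
  - apply: eq_integral => w _; congr EFin; apply: eq_big_seq => i iJ.
    by rewrite /h iJ.
  - move=> i; rewrite /h; case: ifP => // _; split; first exact: measurable_cst.
    exact: integrable0.
  - by move=> i /negbTE iJ x; rewrite /h iJ /=.
elim: J1 J2 h => [|j J1 IH] J2 h hok h0 /= uJ12.
  by apply: integral_prod_ge0 => // i x; exact: h0.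
pose hp i := if i == j then (fun x => (`|h i x| + h i x) / 2) else h i.
pose hm i := if i == j then (fun x => (`|h i x| - h i x) / 2) else h i.
have hpok i : law_integrable (hp i) i.
  rewrite /hp; case: ifP => // _; have [mh hi] := hok i; split.
    apply: measurable_funM => //; apply: measurable_funD => //.
    exact: measurableT_comp.
  rewrite (_ : (fun w => _) = (fun w =>
      (2^-1%:E * ((`|h i (Z i w)|)%:E + (h i (Z i w))%:E))%E)); last first.
    by apply/funext => w; rewrite -EFinD -EFinM mulrC.
  apply: integrableZl => //.
  by apply: integrableD => //; exact: integrable_norm hi.
have hmok i : law_integrable (hm i) i.
  rewrite /hm; case: ifP => // _; have [mh hi] := hok i; split.
    apply: measurable_funM => //; apply: measurable_funB => //.
    exact: measurableT_comp.
  rewrite (_ : (fun w => _) = (fun w =>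
      (2^-1%:E * ((`|h i (Z i w)|)%:E - (h i (Z i w))%:E))%E)); last first.
    by apply/funext => w; rewrite -EFinB -EFinM mulrC.
  apply: integrableZl => //.
  by apply: integrableB => //; exact: integrable_norm hi.
have uJ' : uniq (J1 ++ j :: J2).
  by rewrite -[_ ++ _]/(J1 ++ [:: j] ++ J2) uniq_catCA.
have pE (F : I -> R) : \prod_(i <- j :: J1 ++ J2) F i = \prod_(i <- J1 ++ j :: J2) F i.
  apply: perm_big; rewrite -[X in perm_eq _ X]/(J1 ++ [:: j] ++ J2) perm_sym.
  exact: permEl (perm_catCA _ _ _).
have hp0 i : i \notin J1 -> forall x, 0 <= hp i x.
  move=> iJ1 x; rewrite /hp; have [_|ij] := eqVneq i j; last first.
    by apply: h0; rewrite inE (negbTE ij).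
  by have := ler_norm (- h i x); rewrite normrN; lra.
have hm0 i : i \notin J1 -> forall x, 0 <= hm i x.
  move=> iJ1 x; rewrite /hm; have [_|ij] := eqVneq i j; last first.
    by apply: h0; rewrite inE (negbTE ij).
  by rewrite divr_ge0// subr_ge0 ler_norm.
have prodhp (F : (T' -> R) -> I -> R) : \prod_(i <- j :: J1 ++ J2) F (hp i) i =
    F (hp j) j * \prod_(i <- J1 ++ J2) F (h i) i.
  rewrite big_cons; congr (_ * _); apply: eq_big_seq => i iJ.
  rewrite /hp (_ : i == j = false)//; apply/negbTE; apply: contraTneq iJ => ->.
  by case/andP : uJ12.
have prodhm (F : (T' -> R) -> I -> R) : \prod_(i <- j :: J1 ++ J2) F (hm i) i =
    F (hm j) j * \prod_(i <- J1 ++ J2) F (h i) i.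
  rewrite big_cons; congr (_ * _); apply: eq_big_seq => i iJ.
  rewrite /hm (_ : i == j = false)//; apply/negbTE; apply: contraTneq iJ => ->.
  by case/andP : uJ12.
have hE x : h j x = hp j x - hm j x by rewrite /hp /hm eqxx; lra.
have meanh : law_mean (h j) j = law_mean (hp j) j - law_mean (hm j) j.
  apply: EFin_inj; rewrite EFinB -!meanE//.
  rewrite -integralB//; [|exact: (hpok j).2|exact: (hmok j).2].
  by apply: eq_integral => w _; rewrite hE.
have ip := integrable_prod hpok uJ'.
have im := integrable_prod hmok uJ'.
transitivity (\int[P]_w (\prod_(i <- J1 ++ j :: J2) hp i (Z i w))%:E -
   \int[P]_w (\prod_(i <- J1 ++ j :: J2) hm i (Z i w))%:E)%E.
  rewrite -integralB//; apply: eq_integral => w _; rewrite -EFinB; congr EFin.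
  rewrite -!pE (prodhp (fun g i => g (Z i w))) (prodhm (fun g i => g (Z i w))).
  by rewrite big_cons hE mulrBl.
rewrite !IH// -!pE -EFinB; congr EFin.
by rewrite (prodhp law_mean) (prodhm law_mean) big_cons meanh mulrBl.
Qed.

End independent_product.

(** * Moments of the normal law *)

Lemma expr_le_expR (R : realType) (k : nat) (t : R) : 0 <= t ->
  t ^+ k <= k`!%:R * expR t.
Proof.
case: k => [|k] t0.
  by rewrite expr0 fact0 mul1r -[leLHS]addr0 (le_trans _ (expR_ge1Dx t))// lerD2l.
rewrite mulrC -ler_pdivrMr ?ltr0n ?fact_gt0//.
by rewrite (le_trans _ (expR_ge1Dxn k t0))// lerDr.
Qed.

Section normal_moments.
Context {R : realType} (m s : R).
Hypothesis s0 : s != 0.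
Notation mu := lebesgue_measure.

Let q k x : R := (x - m) ^+ k * normal_fun m s x.

(** Three quarters of the exponent absorb the power of [x - m], and the last
    quarter is a Gaussian of standard deviation [2 * s]. *)
Let q_bound k : exists2 C, 0 <= C & forall x, `|q k x| <= C * normal_fun m (2 * s) x.
Proof.
exists (1 + (8 * s ^+ 2) ^+ k * k`!%:R) => [|x].
  by rewrite addr_ge0// mulr_ge0// exprn_ge0// mulr_ge0// sqr_ge0.
set y := x - m; set t := y ^+ 2 / (8 * s ^+ 2).
have t0 : 0 <= t by rewrite divr_ge0 ?sqr_ge0// mulr_ge0// sqr_ge0.
have -> : normal_fun m (2 * s) x = expR (- t).
  rewrite /normal_fun /t mulNr; congr expR; congr (- (_ * _^-1)).
  by rewrite exprMn; ring.
have -> : q k x = y ^+ k * (expR (- t) * (expR (- t)) ^+ 3).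
  rewrite /q /normal_fun; congr (_ * _); rewrite -exprS -expRM_natl; congr expR.
  by rewrite /t /y; field; rewrite s0.
rewrite normrM [X in _ * X]ger0_norm ?normrX; last first.
  by rewrite mulr_ge0 ?exprn_ge0 ?expR_ge0.
rewrite mulrCA mulrC ler_wpM2r ?expR_ge0//.
have yk : `|y| ^+ k <= (1 + (8 * s ^+ 2) ^+ k * k`!%:R) * expR t.
  apply: (@le_trans _ _ (1 + y ^+ 2 ^+ k)).
    rewrite -normrX -exprM mulnC exprM; move: (y ^+ k) => z.
    have := sqr_ge0 (`|z| - 1); rewrite -[z ^+ 2]real_normK ?num_real//.
    by move: `|z| (normr_ge0 z) => r r0; nra.
  rewrite mulrDl mul1r lerD//.
    by rewrite (le_trans _ (expR_ge1Dx t))// lerDl.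
  have -> : y ^+ 2 = 8 * s ^+ 2 * t by rewrite /t; field; rewrite s0.
  by rewrite exprMn -mulrA ler_wpM2l ?expr_le_expR// exprn_ge0// mulr_ge0// sqr_ge0.
apply: (@le_trans _ _ ((1 + (8 * s ^+ 2) ^+ k * k`!%:R) * expR t * expR (- t) ^+ 3)).
  by rewrite ler_wpM2r// exprn_ge0// expR_ge0.
rewrite exprS -mulrA [expR t * _]mulrA -expRD subrr expR0 mul1r ler_piMr//.
  by rewrite addr_ge0// mulr_ge0// exprn_ge0// mulr_ge0// sqr_ge0.
by rewrite -expRD -[leRHS]expR0 ler_expR -opprD oppr_le0 addr_ge0.
Qed.

Let mq k : measurable_fun setT (q k).
Proof.
apply: measurable_funM; last exact: measurable_normal_fun.
by apply: measurable_funX; exact: measurable_funB.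
Qed.

Let integrable_q k : mu.-integrable setT (EFin \o q k).
Proof.
have [C C0 qC] := q_bound k.
have s20 : 2 * s != 0 by rewrite mulf_neq0.
have h : mu.-integrable setT (fun x => (C * normal_fun m (2 * s) x)%:E).
  have := integrable_normal_pdf m (2 * s); rewrite normal_pdfE// => ig.
  have pk := normal_peak_gt0 s20.
  rewrite (_ : (fun x => _) = (fun x => (C / normal_peak (2 * s))%:E *
     (normal_peak (2 * s) * normal_fun m (2 * s) x)%:E)%E); last first.
    by apply/funext => x; rewrite -EFinM mulrA divfK// gt_eqF.
  exact: integrableZl.
apply: le_integrable h => //.
  by apply/measurable_EFinP; exact: mq.
by move=> x _; rewrite lee_fin (le_trans (qC x))// ler_norm.
Qed.

Let f k (x : R) := k%:R * q k.-1 x - (s ^+ 2)^-1 * q k.+1 x.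

Let is_derive_q k (x : R) : is_derive x (1 : R) (q k) (f k x).
Proof.
pose u : R -> R := fun y => y - m.
have du : is_derive x (1 : R) u 1.
  rewrite (_ : u = id - cst m); last by apply/funext.
  by apply: is_derive_eq; rewrite subr0.
pose c := - (2 * s ^+ 2)^-1.
have -> : q k = (u ^+ k) * (expR \o (c \*: u ^+ 2)).
  apply/funext => y; rewrite /q /normal_fun !fctE /= /c.
  by congr (_ * expR _); rewrite -[RHS]/(_ * _) !mulNr mulr_natl mulrC.
apply: is_derive_eq.
rewrite /f /q /normal_fun !fctE /= /u /GRing.scale /=.
rewrite (_ : - (x - m) ^+ 2 / (s ^+ 2 *+ 2) = c * (x - m) ^+ 2); last first.
  by rewrite /c !mulNr mulr_natl mulrC.
rewrite /c (exprS (x - m) k) expr1; move: (expR _) ((x - m) ^+ k) ((x - m) ^+ k.-1) => e y z.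
by field; rewrite s0.
Qed.

Let continuous_f k : continuous (f k).
Proof.
have cq j : continuous (q j).
  move=> x; apply/differentiable_continuous/derivable1_diffP.
  by have [] := is_derive_q j x.
move=> x; apply: cvgB; apply: cvgM; try exact: cvg_cst; exact: cq.
Qed.

Let integrable_f k : mu.-integrable setT (EFin \o f k).
Proof.
rewrite /f (_ : EFin \o _ = (fun x => k%:R%:E * (q k.-1 x)%:E -
  (s ^+ 2)^-1%:E * (q k.+1 x)%:E)%E); last by apply/funext.
by apply: integrableB => //; apply: integrableZl => //; exact: integrable_q.
Qed.

(** A bound on [q k.+1] is a bound on [(x - m) * q k x]. *)
Let q_decay k : exists2 C, 0 <= C & forall n : nat,
  `|q k (m + n.+1%:R) - q k (m - n.+1%:R)| <= C / n.+1%:R.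
Proof.
have [C C0 qC] := q_bound k.+1.
have key x : x != m -> `|q k x| <= C / `|x - m|.
  move=> xm; rewrite ler_pdivlMr ?normr_gt0 ?subr_eq0// -normrM mulrC.
  have -> : (x - m) * q k x = q k.+1 x by rewrite /q exprS mulrA.
  rewrite (le_trans (qC x))// ler_piMr// /normal_fun -[leRHS]expR0 ler_expR.
  by rewrite mulNr oppr_le0 divr_ge0 ?sqr_ge0// mulrn_wge0// sqr_ge0.
exists (C + C); first by rewrite addr_ge0.
move=> n; have n0 : n.+1%:R != 0 :> R by rewrite pnatr_eq0.
rewrite mulrDl (le_trans (ler_normB _ _))// lerD//.
  rewrite (le_trans (key _ _))//; first by rewrite -subr_eq0 addrAC subrr add0r.
  by rewrite addrAC subrr add0r ger0_norm.
rewrite (le_trans (key _ _))//.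
  by rewrite -subr_eq0 addrAC subrr add0r oppr_eq0.
by rewrite addrAC subrr add0r normrN ger0_norm.
Qed.

(** [f k] is the derivative of [q k], which vanishes at infinity. *)
Let integral_f k : (\int[mu]_x (f k x)%:E = 0)%E.
Proof.
pose I n : set R := `[m - n.+1%:R, m + n.+1%:R]%classic.
have mI n : measurable (I n) by exact: measurable_itv.
have inI x : f k x != 0 -> \forall n \near \oo, I n x.
  move=> _; near=> n; rewrite /I /= in_itv /=.
  have : `|x - m| <= n.+1%:R.
    near: n; exists (Num.truncn `|x - m|) => // n /= nx.
    by rewrite (le_trans (ltW (truncnS_gt _)))// ler_nat ltnS.
  by rewrite ler_norml => /andP[? ?]; apply/andP; split; lra.
have cv := integral_exhaust (integrable_f k) mI inI.
have gE n : (\int[mu]_(x in I n) (f k x)%:E = (q k (m + n.+1%:R) - q k (m - n.+1%:R))%:E)%E.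
  rewrite /I EFinB.
  have mn : m - n.+1%:R < m + n.+1%:R by rewrite ltrD2l gtrN ?ltr0n.
  apply: continuous_FTC2 => //.
  - exact/continuous_subspaceT/continuous_f.
  - split.
    + by move=> x _; have [] := is_derive_q k x.
    + apply: cvg_at_right_filter.
      apply/differentiable_continuous/derivable1_diffP.
      by have [] := is_derive_q k (m - n.+1%:R).
    + apply: cvg_at_left_filter.
      apply/differentiable_continuous/derivable1_diffP.
      by have [] := is_derive_q k (m + n.+1%:R).
  - by move=> x _; rewrite derive1E; have [] := is_derive_q k x.
have [C C0 qC] := q_decay k.
have cv0 : (\int[mu]_(x in I n) (f k x)%:E @[n --> \oo] --> 0)%E.
  rewrite (_ : (fun n => _) = EFin \o (fun n => q k (m + n.+1%:R) - q k (m - n.+1%:R))).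
    apply: cvg_EFin; first exact: nearW.
    apply/norm_cvg0P; apply: (@squeeze_cvgr _ _ _ _ (cst 0) (fun n => C * n.+1%:R^-1)).
    - by apply: nearW => n; rewrite /= normr_ge0 qC.
    - exact: cvg_cst.
    - rewrite -[X in _ --> X](mulr0 C); apply: cvgMr; exact: cvg_harmonic.
  by apply/funext => n; rewrite gE.
exact: cvg_unique cv cv0.
Unshelve. all: by end_near. Qed.

Let integral_qS k : (\int[mu]_x (q k.+1 x)%:E =
  (s ^+ 2 * k%:R)%:E * \int[mu]_x (q k.-1 x)%:E)%E.
Proof.
have fq j : (\int[mu]_x (q j x)%:E)%E \is a fin_num.
  by apply: integrable_fin_num => //; exact: integrable_q.
have := integral_f k; rewrite /f.
under eq_integral do rewrite EFinB (EFinM _ (q k.-1 _)) (EFinM _ (q k.+1 _)).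
rewrite integralB//; last 2 first.
- by apply: integrableZl => //; exact: integrable_q.
- by apply: integrableZl => //; exact: integrable_q.
rewrite !integralZl//; [|exact: integrable_q..].
rewrite -(fineK (fq k.-1)) -(fineK (fq k.+1)) -!EFinM -EFinB => -[] H.
congr EFin; apply: (mulfI (x := (s ^+ 2)^-1)); first by rewrite invr_eq0 expf_neq0.
by rewrite mulrA [X in _ = X * _]mulrA mulVf ?mul1r ?expf_neq0//; lra.
Qed.

Let weight k x : (x - m) ^+ k * normal_pdf m s x = normal_peak s * q k x.
Proof. by rewrite normal_pdfE// /q mulrCA. Qed.

Lemma integrable_normal_moment k :
  (normal_prob m s).-integrable setT (fun x => ((x - m) ^+ k)%:E).
Proof.
apply: (@integrable_weighted_pushforward _ _ _ _ _ mu (normal_prob m s) id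
  (normal_pdf m s)) => //.
- exact: measurable_normal_pdf.
- exact: normal_pdf_ge0.
- by apply: measurable_funX; exact: measurable_funB.
under eq_fun do rewrite weight EFinM.
by apply: integrableZl => //; exact: integrable_q.
Qed.

Let integral_normal_moment k : (\int[normal_prob m s]_x ((x - m) ^+ k)%:E =
  (normal_peak s)%:E * \int[mu]_x (q k x)%:E)%E.
Proof.
rewrite -(@integral_weighted_pushforward _ _ _ _ _ mu (normal_prob m s) id
  (normal_pdf m s))//.
- under eq_integral do rewrite weight EFinM.
  by rewrite integralZl//; exact: integrable_q.
- exact: measurable_normal_pdf.
- exact: normal_pdf_ge0.
- by apply: measurable_funX; exact: measurable_funB.
Qed.

Lemma normal_momentS k : (\int[normal_prob m s]_x ((x - m) ^+ k.+1)%:E =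
  (s ^+ 2 * k%:R)%:E * \int[normal_prob m s]_x ((x - m) ^+ k.-1)%:E)%E.
Proof. by rewrite !integral_normal_moment integral_qS muleCA. Qed.

End normal_moments.

Section gaussian_rv.
Context {d : measure_display} {T : measurableType d} {R : realType}.
Variables (P : probability T R) (W : T -> R) (m s : R).
Hypothesis mW : measurable_fun setT W.
Hypothesis WE : forall B, measurable B -> P [set w | B (W w)] = gaussian_law m s B.

Let integral_one B : measurable B ->
  (\int[P]_(w in W @^-1` B) (cst 1%R w)%:E = gaussian_law m s B)%E.
Proof.
move=> mB; rewrite -[LHS]/(\int[P]_(w in W @^-1` B) (cst 1%E w))%E.
rewrite integral_cst//=; last by rewrite -[X in measurable X]setTI; exact: mW.
by rewrite mul1e; exact: WE.
Qed.

Let integral_normal (f : R -> R) : s != 0 -> measurable_fun setT f ->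
  (\int[P]_w (f (W w))%:E = \int[normal_prob m s]_x (f x)%:E)%E.
Proof.
move=> s0 mf.
rewrite -(@integral_weighted_pushforward _ _ _ _ _ P (normal_prob m s) W (cst 1))//.
  by apply: eq_integral => w _; rewrite mulr1.
by move=> B mB; rewrite integral_one// /gaussian_law (negbTE s0).
Qed.

Let integral_dirac_law (f : R -> R) : s = 0 -> measurable_fun setT f ->
  (\int[P]_w (f (W w))%:E = (f m)%:E)%E.
Proof.
move=> s0 mf.
transitivity (\int[dirac m]_x (f x)%:E)%E.
  rewrite -(@integral_weighted_pushforward _ _ _ _ _ P (dirac m) W (cst 1))//.
    by apply: eq_integral => w _; rewrite mulr1.
  by move=> B mB; rewrite integral_one// /gaussian_law s0 eqxx.
by rewrite integral_dirac//= ?diracT ?mul1e//; exact/measurable_EFinP.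
Qed.

Let mX k : measurable_fun setT (fun x : R => (x - m) ^+ k).
Proof. by apply: measurable_funX; exact: measurable_funB. Qed.

Lemma integrable_gaussian_moment k :
  P.-integrable setT (fun w => ((W w - m) ^+ k)%:E).
Proof.
apply/integrableP; split.
  by apply/measurable_EFinP; apply: measurable_funX; exact: measurable_funB.
have mabs : measurable_fun setT (fun x : R => `|(x - m) ^+ k|).
  by apply: measurableT_comp => //; exact: mX.
have [s0|s0] := eqVneq s 0.
  by rewrite (integral_dirac_law s0 mabs) ltry.
rewrite (integral_normal s0 mabs).
by have /integrableP[_] := integrable_normal_moment m s0 k.
Qed.

Lemma gaussian_momentS k : (\int[P]_w ((W w - m) ^+ k.+1)%:E =
  (s ^+ 2 * k%:R)%:E * \int[P]_w ((W w - m) ^+ k.-1)%:E)%E.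
Proof.
have [s0|s0] := eqVneq s 0.
  rewrite (integral_dirac_law s0 (mX k.+1)) (integral_dirac_law s0 (mX k.-1)).
  by rewrite s0 subrr expr0n/= expr0n mul0r mul0e.
by rewrite (integral_normal s0 (mX k.+1)) (integral_normal s0 (mX k.-1)) normal_momentS.
Qed.

End gaussian_rv.

(** * Mixed moments of a Gaussian pair *)

Lemma poly_eqP_eval (R : numDomainType) (p q : {poly R}) :
  (forall u, p.[u] = q.[u]) -> p = q.
Proof.
move=> pq; apply/eqP; rewrite -subr_eq0; apply/negPn/negP => pq0.
pose rs := [seq i%:R : R | i <- iota 0 (size (p - q))].
have := @max_poly_roots _ (p - q) rs pq0.
rewrite size_map size_iota ltnn => H; suff : false by []; apply: H.
  by apply/allP => x _; rewrite /root hornerD hornerN pq subrr.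
by rewrite map_inj_uniq ?iota_uniq// => i j /eqP; rewrite eqr_nat => /eqP.
Qed.

Section expectation_linear.
Context {d : measure_display} {T : measurableType d} {R : realType}.
Variable P : probability T R.

Definition integrable_rv (f : T -> R) := P.-integrable setT (EFin \o f).

Lemma integrable_rvZ c f : integrable_rv f -> integrable_rv (fun w => c * f w).
Proof. by move=> fi; exact: (integrableZl measurableT c fi). Qed.

Lemma integrable_rvD f g : integrable_rv f -> integrable_rv g ->
  integrable_rv (fun w => f w + g w).
Proof. by move=> fi gi; exact: (integrableD measurableT fi gi). Qed.

Lemma integrable_rv_sum (I : Type) (r : seq I) (f : I -> T -> R) :
  (forall i, integrable_rv (f i)) -> integrable_rv (fun w => \sum_(i <- r) f i w).
Proof.
move=> fi; elim: r => [|i r IH].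
  by under eq_fun do rewrite big_nil; exact: integrable0.
by under eq_fun do rewrite big_cons; exact: integrable_rvD.
Qed.

Lemma RintegralT_Z c (f : T -> R) : integrable_rv f ->
  \int[P]_w (c * f w) = c * \int[P]_w f w.
Proof. by move=> fi; rewrite RintegralZl. Qed.

Lemma RintegralT_D (f g : T -> R) : integrable_rv f -> integrable_rv g ->
  \int[P]_w (f w + g w) = \int[P]_w f w + \int[P]_w g w.
Proof. by move=> fi gi; rewrite RintegralD. Qed.

Lemma RintegralT_sum (I : Type) (r : seq I) (f : I -> T -> R) :
  (forall i, integrable_rv (f i)) ->
  \int[P]_w (\sum_(i <- r) f i w) = \sum_(i <- r) \int[P]_w f i w.
Proof.
move=> fi; elim: r => [|i r IH].
  by rewrite big_nil; under eq_Rintegral do rewrite big_nil; rewrite Rintegral_cst// mul0r.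
under eq_Rintegral do rewrite big_cons.
by rewrite big_cons RintegralT_D// ?IH//; exact: integrable_rv_sum.
Qed.

Lemma RintegralT_cst (c : R) : \int[P]_w c = c.
Proof.
by rewrite Rintegral_cst//; have := probability_setT P; rewrite /= => ->; rewrite mulr1.
Qed.

End expectation_linear.

(** The moments of the centred normal law of variance [v]. *)
Fixpoint gauss_moment (R : pzSemiRingType) (v : R) (k : nat) : R :=
  match k with
  | 0 => 1
  | 1 => 0
  | k'.+2 => v * k'.+1%:R * gauss_moment v k'
  end.

Section gauss_convolution.
Variables (R : numFieldType) (v : R).
Let h k := gauss_moment v k / k`!%:R.

Let hS k : k.+2%:R * h k.+2 = v * h k.
Proof.
rewrite /h /= !factS !natrM; field.
by rewrite nat1r -natrD !pnatr_eq0 -lt0n fact_gt0.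
Qed.

(** Here [h k] is the k-th moment over [k`!], so that the sums are moments
    over factorials of [u * X + Y] for independent [X] and [Y]. The identity
    is the recursion for the variance [v * (u ^+ 2 + 1)]; it follows from
    [hS] after [n.+2] is written as [j + (n.+2 - j)] in each term. *)
Lemma gauss_convolution n u :
  n.+2%:R * (\sum_(j < n.+3) h j * h (n.+2 - j) * u ^+ j) =
  v * (u ^+ 2 + 1) * \sum_(j < n.+1) h j * h (n - j) * u ^+ j.
Proof.
have h1 : h 1 = 0 by rewrite /h mul0r.
transitivity (\sum_(j < n.+3) (j%:R * h j) * h (n.+2 - j) * u ^+ j +
   \sum_(j < n.+3) h j * ((n.+2 - j)%:R * h (n.+2 - j)) * u ^+ j).
  rewrite mulr_sumr -big_split/=; apply: eq_bigr => j _.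
  have -> : n.+2%:R = j%:R + (n.+2 - j)%:R :> R by rewrite -natrD subnKC// -ltnS.
  by ring.
rewrite mulrDr mulr1 mulrDl; congr (_ + _).
  rewrite 2!big_ord_recl /= mul0r !mul0r add0r h1 mulr0 !mul0r add0r mulr_sumr.
  apply: eq_bigr => j _ /=; rewrite /bump !add1n hS !subSS exprS exprS; ring.
rewrite 2!big_ord_recr /= subnn mul0r mulr0 mul0r addr0 subSnn h1 !mulr0 mul0r addr0.
rewrite mulr_sumr; apply: eq_bigr => j _.
have jn : (j <= n)%N by rewrite -ltnS.
by rewrite !subSn ?(leq_trans jn)// hS; ring.
Qed.
End gauss_convolution.

Section gaussian_pair.
Context {d : measure_display} {T : measurableType d} {R : realType}.
Variables (P : probability T R) (X Y : T -> R) (v : R).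
Hypotheses (mX : measurable_fun setT X) (mY : measurable_fun setT Y).
Hypothesis gaussXY : forall u w : R, exists m s : R, forall B : set R,
  measurable B -> P [set t | B (u * X t + w * Y t)] = gaussian_law m s B.
Hypothesis EX : \int[P]_t X t = 0.
Hypothesis EY : \int[P]_t Y t = 0.

Let mW u w : measurable_fun setT (fun t => u * X t + w * Y t).
Proof. by apply: measurable_funD; apply: measurable_funM. Qed.

Let gauss_mean (W : T -> R) m s : measurable_fun setT W ->
  (forall B, measurable B -> P [set t | B (W t)] = gaussian_law m s B) ->
  integrable_rv P W /\ \int[P]_t W t = m.
Proof.
move=> mW0 WE.
have i1 : integrable_rv P (fun t => W t - m).
  by have := integrable_gaussian_moment mW0 WE 1; rewrite /integrable_rv /comp;
     under eq_fun do rewrite expr1.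
have ic : integrable_rv P (cst m).
  exact: finite_measure_integrable_cst.
have iW : integrable_rv P W.
  rewrite (_ : W = (fun t => (W t - m) + cst m t)); first exact: integrable_rvD.
  by apply/funext => t; rewrite subrK.
split => //.
have : \int[P]_t (W t - m) = 0.
  have := gaussian_momentS mW0 WE 0; rewrite mulr0 mul0e => E0.
  by rewrite /Rintegral (_ : (fun _ => _) = (fun t => ((W t - m) ^+ 1)%:E)) ?E0.
have icN : integrable_rv P (cst (- m)) by exact: finite_measure_integrable_cst.
have -> : \int[P]_t (W t - m) = \int[P]_t W t - m.
  by rewrite (RintegralT_D iW icN) RintegralT_cst.
by move/eqP; rewrite subr_eq0 => /eqP.
Qed.

Let iX : integrable_rv P X.
Proof.
have [m [s H]] := gaussXY 1 0.
rewrite (_ : X = (fun t => 1 * X t + 0 * Y t)); last first.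
  by apply/funext => t; rewrite mul1r mul0r addr0.
by have [] := gauss_mean (mW 1 0) H.
Qed.

Let iY : integrable_rv P Y.
Proof.
have [m [s H]] := gaussXY 0 1.
rewrite (_ : Y = (fun t => 0 * X t + 1 * Y t)); last first.
  by apply/funext => t; rewrite mul1r mul0r add0r.
by have [] := gauss_mean (mW 0 1) H.
Qed.

Let centered u w : exists s : R, forall B : set R,
  measurable B -> P [set t | B (u * X t + w * Y t)] = gaussian_law 0 s B.
Proof.
have [m [s H]] := gaussXY u w; exists s.
suff <- : m = 0 by [].
have [_ <-] := gauss_mean (mW u w) H.
rewrite RintegralT_D; [|exact: integrable_rvZ..].
by rewrite !RintegralT_Z// EX EY !mulr0 addr0.
Qed.

Let iW u w k : integrable_rv P (fun t => (u * X t + w * Y t) ^+ k).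
Proof.
have [s H] := centered u w.
have := integrable_gaussian_moment (mW u w) H k.
by rewrite /integrable_rv /comp; under eq_fun do rewrite subr0.
Qed.

Lemma integrable_mixed j l : integrable_rv P (fun t => X t ^+ j * Y t ^+ l).
Proof.
have iXk k : integrable_rv P (fun t => X t ^+ k).
  have := iW 1 0 k; rewrite (_ : (fun _ => _) = (fun t => X t ^+ k))//.
  by apply/funext => t; rewrite mul1r mul0r addr0.
have iYk k : integrable_rv P (fun t => Y t ^+ k).
  have := iW 0 1 k; rewrite (_ : (fun _ => _) = (fun t => Y t ^+ k))//.
  by apply/funext => t; rewrite mul1r mul0r add0r.
have := integrable_rvD (iXk (j * 2)%N) (iYk (l * 2)%N).
apply: le_integrable => //.
  by apply/measurable_EFinP; apply: measurable_funM; exact: measurable_funX.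
move=> t _; rewrite lee_fin !exprM.
move: (X t ^+ j) (Y t ^+ l) => x y.
rewrite [leRHS]ger0_norm ?addr_ge0 ?sqr_ge0// normrM.
rewrite -[x ^+ 2]real_normK ?num_real// -[y ^+ 2]real_normK ?num_real//.
have := sqr_ge0 (`|x| - `|y|); have := mulr_ge0 (normr_ge0 x) (normr_ge0 y).
by move: `|x| `|y| => a b ? ?; nra.
Qed.

Hypothesis EXX : \int[P]_t (X t ^+ 2) = v.
Hypothesis EYY : \int[P]_t (Y t ^+ 2) = v.
Hypothesis EXY : \int[P]_t (X t * Y t) = 0.

Let G u k := \int[P]_t ((u * X t + Y t) ^+ k).

Let G0 u : G u 0 = 1.
Proof. by rewrite /G; under eq_Rintegral do rewrite expr0; exact: RintegralT_cst. Qed.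

Let G1 u : G u 1 = 0.
Proof.
rewrite /G; under eq_Rintegral do rewrite expr1.
by rewrite RintegralT_D ?RintegralT_Z ?EX ?EY ?mulr0 ?addr0//; exact: integrable_rvZ.
Qed.

Let G2 u : G u 2 = v * (u ^+ 2 + 1).
Proof.
rewrite /G (_ : (fun _ => _) = (fun t => u ^+ 2 * X t ^+ 2 + (2 * u * (X t * Y t) + Y t ^+ 2))).
  have i1 := integrable_mixed 2 0; have i2 := integrable_mixed 1 1.
  have i3 := integrable_mixed 0 2.
  have {}i1 : integrable_rv P (fun t => X t ^+ 2).
    by move: i1; under eq_fun do rewrite expr0 mulr1.
  have {}i2 : integrable_rv P (fun t => X t * Y t) by [].
  have {}i3 : integrable_rv P (fun t => Y t ^+ 2).
    by move: i3; under eq_fun do rewrite expr0 mul1r.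
  rewrite RintegralT_D; [|exact: integrable_rvZ|by apply: integrable_rvD => //; exact: integrable_rvZ].
  rewrite RintegralT_D//; last exact: integrable_rvZ.
  by rewrite !RintegralT_Z// EXX EYY EXY; ring.
by apply/funext => t; ring.
Qed.

Let GS u k : G u k.+2 = v * (u ^+ 2 + 1) * k.+1%:R * G u k.
Proof.
have [s H] := centered u 1.
have rec j : G u j.+1 = s ^+ 2 * j%:R * G u j.-1.
  have := gaussian_momentS (mW u 1) H j.
  have E i : (fun w => ((u * X w + 1 * Y w - 0) ^+ i)%:E) =
             (fun w => ((u * X w + Y w) ^+ i)%:E).
    by apply/funext => w; rewrite subr0 mul1r.
  rewrite !E /G /Rintegral => ->.
  rewrite fineM//; apply: integrable_fin_num => //.
  have := iW u 1 j.-1; rewrite /integrable_rv /comp.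
  by under eq_fun do rewrite mul1r.
rewrite rec /= -(_ : s ^+ 2 = v * (u ^+ 2 + 1))//.
by rewrite -G2 rec /= G0 !mulr1.
Qed.

(** Each [u * X + Y] is normal of variance [v * (u ^+ 2 + 1)], hence has the
    same moments as in the case of independent [X] and [Y]. These moments
    are polynomials in [u] whose coefficients are the mixed moments, up to
    binomial factors. *)
Lemma gaussian_mixed_moment j l :
  \int[P]_t (X t ^+ j * Y t ^+ l) = gauss_moment v j * gauss_moment v l.
Proof.
pose h k := gauss_moment v k / k`!%:R.
pose M i := \int[P]_t (X t ^+ i.1 * Y t ^+ i.2).
pose p n := \poly_(i < n.+1) (M (i, n - i)%N / (i`!%:R * (n - i)`!%:R)).
pose r n := \poly_(i < n.+1) (h i * h (n - i)%N).
have f0 n : n`!%:R != 0 :> R by rewrite pnatr_eq0 -lt0n fact_gt0.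
have pE n u : n`!%:R * (p n).[u] = G u n.
  rewrite /G; under eq_Rintegral do rewrite addrC exprDn.
  rewrite (_ : (fun _ => _) = (fun t => \sum_(i < n.+1)
     ('C(n, i)%:R * u ^+ i) * (X t ^+ i * Y t ^+ (n - i)))); last first.
    apply/funext => t; apply: eq_bigr => i _.
    by rewrite exprMn -mulr_natl; ring.
  rewrite RintegralT_sum => [|i]; last by apply: integrable_rvZ; exact: integrable_mixed.
  rewrite horner_poly mulr_sumr; apply: eq_bigr => i _.
  rewrite RintegralT_Z; last exact: integrable_mixed.
  have iN : (i <= n)%N by rewrite -ltnS.
  rewrite -(bin_fact iN) !natrM -/(M ((i : nat), n - i)%N).
  by field; rewrite !f0.
have rE n u : n`!%:R * (r n).[u] = G u n.
  have : n`!%:R * (r n).[u] = G u n /\ n.+1`!%:R * (r n.+1).[u] = G u n.+1.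
    elim: n => [|n [IH0 IH1]]; split => //.
    - by rewrite horner_poly big_ord1 G0 /h /= fact0 !divr1 !mulr1.
    - by rewrite horner_poly 2!big_ord_recl big_ord0 G1 /h /= !(mul0r, mulr0, addr0).
    rewrite GS -IH0 !factS 2!natrM !horner_poly.
    have := gauss_convolution v n u; rewrite -/h => H.
    transitivity (n.+1%:R * n`!%:R * (n.+2%:R * \sum_(i < n.+3) h i * h (n.+2 - i)%N * u ^+ i)).
      by ring.
    by rewrite H; ring.
  by case.
have pr n : p n = r n.
  by apply: poly_eqP_eval => u; apply: (mulfI (f0 n)); rewrite pE rE.
have := congr1 (fun q : {poly R} => q`_j) (pr (j + l)%N).
rewrite !coef_poly ltnS leq_addr addKn /M /= /h => H.
have := congr1 (fun x => x * (j`!%:R * l`!%:R)) H.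
rewrite divfK ?mulf_neq0// => ->.
by field; rewrite !f0.
Qed.

End gaussian_pair.

(** * Weierstrass approximation *)

Section bernstein.
Variable R : realType.

(** The Bernstein polynomial with values [phi 0, ..., phi n] at the nodes,
    as the mean of [phi] over the number of successes in [n] trials,
    conditioned on the first trial. The recursion makes positivity and the
    variance plain inductions. *)
Fixpoint bernstein (n : nat) (phi : nat -> R) : {poly R} :=
  if n is n'.+1 then
    'X * bernstein n' (fun k => phi k.+1) + (1 - 'X) * bernstein n' phi
  else (phi 0)%:P.

Lemma bernsteinS n phi x : (bernstein n.+1 phi).[x] =
  x * (bernstein n (fun k => phi k.+1)).[x] + (1 - x) * (bernstein n phi).[x].
Proof. by rewrite /= hornerD !hornerM hornerX hornerD hornerN hornerX hornerC. Qed.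

Lemma bernstein_lin n a b phi psi x :
  (bernstein n (fun k => a * phi k + b * psi k)).[x] =
  a * (bernstein n phi).[x] + b * (bernstein n psi).[x].
Proof.
elim: n phi psi => [|n IH] phi psi; first by rewrite /= !hornerC.
by rewrite !bernsteinS !IH; ring.
Qed.

Lemma bernstein_le n phi psi x : 0 <= x <= 1 ->
  (forall k, (k <= n)%N -> phi k <= psi k) ->
  (bernstein n phi).[x] <= (bernstein n psi).[x].
Proof.
move=> /andP[x0 x1]; elim: n phi psi => [|n IH] phi psi le.
  by rewrite /= !hornerC le.
rewrite !bernsteinS lerD// ler_wpM2l ?subr_ge0//; apply: IH => k kn.
  exact: le.
by apply: le; rewrite (leq_trans kn).
Qed.

Lemma bernstein_cst n a x : (bernstein n (fun=> a)).[x] = a.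
Proof.
elim: n => [|n IH]; first by rewrite /= hornerC.
by rewrite bernsteinS IH; ring.
Qed.

Lemma bernstein_variance n c x : (bernstein n (fun k => (k%:R - c) ^+ 2)).[x] =
  n%:R * x * (1 - x) + (n%:R * x - c) ^+ 2.
Proof.
elim: n c => [|n IH] c; first by rewrite /= hornerC; ring.
rewrite bernsteinS IH.
rewrite (_ : (fun k => (k.+1%:R - c) ^+ 2) = (fun k => (k%:R - (c - 1)) ^+ 2)).
  by rewrite IH -[n.+1%:R]natr1; ring.
by apply/funext => k; rewrite -[k.+1%:R]natr1; ring.
Qed.

(** The error is a binomial mean of [f t - f x], and the variance of [t] is
    at most [n.+1%:R^-1]. *)
Lemma bernstein_approx n (f : R -> R) e C x : 0 <= x <= 1 ->
  (forall t, 0 <= t <= 1 -> `|f t - f x| <= e + C * (t - x) ^+ 2) ->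
  0 <= C ->
  `|(bernstein n.+1 (fun k => f (k%:R / n.+1%:R))).[x] - f x| <= e + C / n.+1%:R.
Proof.
move=> x01 fx C0; set N : R := n.+1%:R.
have N0 : 0 < N by rewrite ltr0n.
pose psi k : R := e + C * (k%:R / N - x) ^+ 2.
have psiE : (bernstein n.+1 psi).[x] <= e + C / N.
  have -> : psi = fun k => 1 * (fun=> e) k +
      C / N ^+ 2 * (fun k => (k%:R - N * x) ^+ 2) k.
    apply/funext => k; rewrite /psi mul1r; congr (_ + _).
    by field; rewrite gt_eqF.
  rewrite (bernstein_lin _ _ _ (fun=> e)) bernstein_cst bernstein_variance subrr.
  rewrite -/N expr0n/= addr0 mul1r lerD2l.
  have -> : C / N ^+ 2 * (N * x * (1 - x)) = C / N * (x * (1 - x)).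
    by field; rewrite gt_eqF.
  rewrite ler_piMr ?divr_ge0 ?(ltW N0)//.
  by move/andP : x01 => [x0 x1]; have := sqr_ge0 x; lra.
have kN k : (k <= n.+1)%N -> 0 <= k%:R / N <= 1.
  move=> kn; rewrite divr_ge0 ?(ltW N0)//= ler_pdivrMr// mul1r ler_nat //.
set phi := fun k => f (k%:R / N).
have bl phi' : (bernstein n.+1 (fun k => phi' k - f x)).[x] = (bernstein n.+1 phi').[x] - f x.
  rewrite (_ : (fun k => _) = (fun k => 1 * phi' k + -1 * (fun=> f x) k)).
    by rewrite bernstein_lin bernstein_cst; ring.
  by apply/funext => k; ring.
rewrite ler_norml -bl; apply/andP; split; last first.
  apply: le_trans psiE; apply: bernstein_le => // k kn.
  by rewrite (le_trans (ler_norm _))// fx// kN.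
rewrite lerNl (le_trans _ psiE)//.
have -> : - (bernstein n.+1 (fun k => phi k - f x)).[x] =
    (bernstein n.+1 (fun k => -1 * (phi k - f x) + 0 * psi k)).[x].
  by rewrite bernstein_lin; ring.
apply: bernstein_le => // k kn.
by rewrite mul0r addr0 mulN1r (le_trans (ler_norm _))// normrN fx// kN.
Qed.

(** Uniform continuity handles the close pairs, and the bound [M] the
    distant ones. *)
Lemma quadratic_modulus (f : R -> R) (a b M e : R) : continuous f ->
  (forall x, `|f x| <= M) -> 0 < e -> exists2 C, 0 <= C &
  forall x y, a <= x <= b -> `|f y - f x| <= e + C * (y - x) ^+ 2.
Proof.
move=> cf fM e0.
have M0 : 0 <= M by rewrite (le_trans _ (fM 0)).
have /compact_near_coveringP cov : compact `[a, b]%classic := @segment_compact _ a b.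
have : \forall r \near (0 : R)^'+, `[a, b]%classic `<=`
    [set x | forall y, `|y - x| < r -> `|f y - f x| < e].
  apply: (cov _ _ (fun r x => forall y, `|y - x| < r -> `|f y - f x| < e)) => x _.
  have e20 : 0 < e / 2 by rewrite divr_gt0.
  have /cvgrPdist_lt/(_ _ e20)/nbhs_ballP[eta /= eta0 fx] := cf x.
  have eta20 : 0 < eta / 2 by rewrite divr_gt0.
  near=> x' r => y yx'.
  have x'x : `|x - x'| < eta / 2.
    by near: x'; exact: (nbhsx_ballx x _ eta20).
  have reta : r < eta / 2 by near: r; exact: nbhs_right_lt.
  have f1 := fx _ (lt_trans x'x _ : ball x eta x').
  have f2 : `|f x - f y| < e / 2.
    apply: fx; rewrite /ball /= (le_lt_trans (ler_distD x' _ _))//.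
    by rewrite [ltRHS]splitr ltrD// distrC (lt_trans yx').
  rewrite (le_lt_trans (ler_distD (f x) _ _))// [ltRHS]splitr ltrD//.
    by rewrite distrC.
  by apply: f1; rewrite ltr_pdivrMr// ltr_pMr// ltr1n.
rewrite near_withinE => /nbhs_ballP[d /= d0 H].
have H2 x y : a <= x <= b -> `|y - x| < d / 2 -> `|f y - f x| < e.
  move=> xab; apply: (H (d / 2)) => //=; last by rewrite divr_gt0.
  by rewrite /ball /= sub0r normrN gtr0_norm ?divr_gt0// ltr_pdivrMr// ltr_pMr// ltr1n.
have C0 : 0 <= 2 * M / (d / 2) ^+ 2.
  by apply: divr_ge0; [rewrite mulr_ge0|rewrite sqr_ge0].
exists (2 * M / (d / 2) ^+ 2) => // x y xab.
have [yx|yx] := ltP `|y - x| (d / 2).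
  rewrite (le_trans (ltW (H2 x y xab yx)))// lerDl mulr_ge0 ?sqr_ge0//.
rewrite (le_trans (ler_normB _ _))// (@le_trans _ _ (2 * M))//.
  by rewrite mulr_natl mulr2n lerD.
rewrite ler_wpDl ?(ltW e0)// mulrAC -mulrA ler_peMr ?mulr_ge0//.
rewrite ler_pdivlMr ?exprn_gt0 ?divr_gt0// mul1r.
by rewrite -[leRHS]real_normK ?num_real// ler_sqr ?nnegrE// divr_ge0// ltW.
Unshelve. all: by end_near. Qed.

Lemma weierstrass (f : R -> R) (K M e : R) : continuous f ->
  (forall x, `|f x| <= M) -> 0 < K -> 0 < e ->
  exists p : {poly R}, forall x, - K <= x <= K -> `|f x - p.[x]| <= e.
Proof.
move=> cf fM K0 e0.
pose g (t : R) := f (2 * K * t - K).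
have cg : continuous g.
  move=> t; apply: continuous_comp; last exact: cf.
  by apply: cvgB; [apply: cvgM; [exact: cvg_cst|exact: cvg_id]|exact: cvg_cst].
have e20 : 0 < e / 2 by rewrite divr_gt0.
have [C C0 gC] := @quadratic_modulus g 0 1 M (e / 2) cg (fun t => fM _) e20.
pose n := Num.truncn (C / (e / 2)).
exists (bernstein n.+1 (fun k => g (k%:R / n.+1%:R)) \Po
  ((2 * K)^-1 *: ('X + K%:P))) => x xK.
rewrite horner_comp; have -> : ((2 * K)^-1 *: ('X + K%:P)).[x] = (2 * K)^-1 * (x + K).
  by rewrite hornerZ hornerD hornerX hornerC.
set t := (2 * K)^-1 * (x + K).
have t01 : 0 <= t <= 1.
  by rewrite /t mulrC divr_ge0 ?ler_pdivrMr ?mulr_gt0// ?mulr_ge0 ?(ltW K0)//=; lra.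
have -> : f x = g t by rewrite /g /t; congr f; field; rewrite gt_eqF.
rewrite distrC (le_trans (bernstein_approx n t01 (fun s s01 => gC t s t01) C0))//.
rewrite [leRHS]splitr lerD2l ler_pdivrMr// mulrC -ler_pdivrMr//.
by rewrite ltW// truncnS_gt.
Qed.

End bernstein.

(** * From convergence of moments to weak convergence *)

Section average.
Variable R : realType.
Definition average (s : seq R) (f : R -> R) : R :=
  (size s)%:R^-1 * \sum_(x <- s) f x.

Lemma averageD s f g : average s (fun x => f x + g x) = average s f + average s g.
Proof. by rewrite /average big_split mulrDr. Qed.

Lemma averageZ s c f : average s (fun x => c * f x) = c * average s f.
Proof. by rewrite /average -mulr_sumr mulrCA. Qed.

Lemma average_sum (I : Type) (r : seq I) s (f : I -> R -> R) :
  average s (fun x => \sum_(i <- r) f i x) = \sum_(i <- r) average s (f i).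
Proof. by rewrite /average exchange_big mulr_sumr. Qed.

Lemma average_cst s c : (0 < size s)%N -> average s (fun=> c) = c.
Proof.
move=> s0; rewrite /average big_const_seq count_predT iter_addr_0 -[c *+ _]mulr_natl mulrA mulVf ?mul1r//.
by rewrite pnatr_eq0 -lt0n.
Qed.

Lemma norm_average s f g : (forall x, `|f x| <= g x) -> `|average s f| <= average s g.
Proof.
move=> fg; rewrite normrM ger0_norm ?invr_ge0// ler_wpM2l ?invr_ge0//.
by rewrite (le_trans (ler_norm_sum _ _ _))// ler_sum.
Qed.
End average.

Section moment_method.
Context {R : realType}.
Notation mu := lebesgue_measure.
Variables (L : R) (Y : R -> R).
Hypothesis L0 : 0 <= L.
Hypothesis Y0 : forall x, 0 <= Y x.
Hypothesis mY : measurable_fun setT Y.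
Hypothesis iY : mu.-integrable setT (EFin \o Y).
Hypothesis Y1 : \int[mu]_x Y x = 1.
Hypothesis Ysupp : forall x, ~~ (0 <= x <= L) -> Y x = 0.

Definition density_mean (f : R -> R) : R := \int[mu]_x (f x * Y x).

Let iYC C : mu.-integrable setT (fun x => (C * Y x)%:E).
Proof. by have := integrableZl measurableT C iY. Qed.

Lemma integrable_density_mean (f : R -> R) C : measurable_fun setT f ->
  (forall x, 0 <= x <= L -> `|f x| <= C) ->
  mu.-integrable setT (fun x => (f x * Y x)%:E).
Proof.
move=> mf fC; apply: le_integrable (iYC C) => //.
  by apply/measurable_EFinP; exact: measurable_funM.
move=> x _; rewrite lee_fin; have [xL|/Ysupp ->] := boolP (0 <= x <= L); last first.
  by rewrite !mulr0 normr0.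
have C0 : 0 <= C by rewrite (le_trans _ (fC x xL)).
by rewrite [leRHS]ger0_norm ?mulr_ge0// normrM (ger0_norm (Y0 x)) ler_wpM2r// fC.
Qed.

Lemma density_mean_bound (f : R -> R) C : measurable_fun setT f ->
  (forall x, 0 <= x <= L -> `|f x| <= C) -> `|density_mean f| <= C.
Proof.
move=> mf fC; have fi := integrable_density_mean mf fC.
rewrite (le_trans (le_normr_Rintegral measurableT fi))//.
have -> : C = \int[mu]_x (C * Y x) by rewrite RintegralZl// Y1 mulr1.
apply: le_Rintegral => //; [exact: integrable_norm fi|exact: iYC|].
move=> x _; rewrite normrM (ger0_norm (Y0 x)).
have [xL|/Ysupp ->] := boolP (0 <= x <= L); last by rewrite !mulr0.
by rewrite ler_wpM2r// fC.
Qed.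

Let measurable_horner (p : {poly R}) : measurable_fun setT (horner p).
Proof. by apply: continuous_measurable_fun; exact: continuous_horner. Qed.

Let horner_bound (p : {poly R}) : exists C, forall x, 0 <= x <= L -> `|p.[x]| <= C.
Proof.
exists (\sum_(i < size p) `|p`_i| * L ^+ i) => x /andP[x0 xL].
rewrite horner_coef (le_trans (ler_norm_sum _ _ _))// ler_sum// => i _.
by rewrite normrM ler_wpM2l// normrX ger0_norm// lerXn2r.
Qed.

Let bounded_sub (f : R -> R) M (p : {poly R}) : (forall x, `|f x| <= M) ->
  exists C, forall x, 0 <= x <= L -> `|f x - p.[x]| <= C.
Proof.
move=> fM; have [C pC] := horner_bound p; exists (M + C) => x xL.
by rewrite (le_trans (ler_normB _ _))// lerD// pC.
Qed.

Lemma density_mean_poly (p : {poly R}) :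
  density_mean (horner p) = \sum_(i < size p) p`_i * density_mean (fun x => x ^+ i).
Proof.
rewrite /density_mean.
transitivity (\int[mu]_x (\sum_(i < size p) p`_i * (x ^+ i * Y x))).
  apply: eq_Rintegral => x _; rewrite horner_coef mulr_suml.
  by apply: eq_bigr => i _; rewrite mulrA.
have iXi i : mu.-integrable setT (fun x => (x ^+ i * Y x)%:E).
  apply: (@integrable_density_mean (fun x => x ^+ i) (L ^+ i)).
    by apply: measurable_funX; exact: measurable_id.
  by move=> x /andP[x0 xL]; rewrite normrX ger0_norm// lerXn2r.
suff H (r : seq 'I_(size p)) :
    mu.-integrable setT (fun x => (\sum_(i <- r) p`_i * (x ^+ i * Y x))%:E) /\
    \int[mu]_x (\sum_(i <- r) p`_i * (x ^+ i * Y x)) =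
    \sum_(i <- r) p`_i * \int[mu]_x (x ^+ i * Y x) by have [] := H (index_enum _).
have iZ i c : mu.-integrable setT (fun x => (c * (x ^+ i * Y x))%:E).
  exact: (integrableZl measurableT c (iXi i)).
elim: r => [|i r [IHi IH]].
  split; first by under eq_fun do rewrite big_nil; exact: integrable0.
  rewrite big_nil; under eq_Rintegral do rewrite big_nil.
  by rewrite Rintegral_cst// mul0r.
split.
  under eq_fun do rewrite big_cons.
  exact: (integrableD measurableT (iZ i p`_i) IHi).
rewrite big_cons -IH -(RintegralZl _ _ (iXi i))// -RintegralD//.
  by apply: eq_Rintegral => x _; rewrite big_cons.
exact: iZ.
Qed.

Variable s_ : nat -> seq R.
Hypothesis size_s : forall n, size (s_ n) = n.
Hypothesis moments : forall k,
  average (s_ n) (fun x => x ^+ k) @[n --> \oo] --> density_mean (fun x => x ^+ k).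

Lemma average_poly_cvg (p : {poly R}) :
  average (s_ n) (horner p) @[n --> \oo] --> density_mean (horner p).
Proof.
rewrite density_mean_poly.
rewrite (_ : (fun n => _) = (fun n =>
    \sum_(i < size p) p`_i * average (s_ n) (fun x => x ^+ i))).
  elim: (index_enum _) => [|i r IH].
    by under eq_fun do rewrite big_nil; rewrite big_nil; exact: cvg_cst.
  under eq_fun do rewrite big_cons; rewrite big_cons.
  by apply: cvgD => //; apply: cvgMr; exact: moments.
apply/funext => n; under eq_bigr do rewrite -averageZ.
rewrite -average_sum; congr average; apply/funext => x.
by rewrite horner_coef.
Qed.

(** Beyond the interval where [p] approximates [f], the difference is of
    polynomial growth and is dominated by a multiple of a high even power;
    as the interval is larger than [[0, L]], the mean of this power over
    [[0, L]] can be made small. *)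
Lemma poly_sandwich (f : R -> R) M e : continuous f -> (forall x, `|f x| <= M) -> 0 < e ->
  exists p r : {poly R}, [/\ (forall x, `|f x - p.[x]| <= e + r.[x]),
    (forall x, 0 <= r.[x]) & density_mean (horner r) <= e].
Proof.
move=> cf fM e0; pose K := L + 1.
have K0 : 0 < K by rewrite ltr_wpDl.
have K1 : 1 <= K by rewrite lerDr.
have M0 : 0 <= M by rewrite (le_trans _ (fM 0)).
have [p fp] := weierstrass cf fM K0 e0.
pose B := \sum_(i < size p) `|p`_i|.
have B0 : 0 <= B by rewrite sumr_ge0.
pose d := size p.
have pB x : 1 <= `|x| -> `|p.[x]| <= B * `|x| ^+ d.
  move=> x1; rewrite horner_coef (le_trans (ler_norm_sum _ _ _))//.
  rewrite /B mulr_suml ler_sum// => i _.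
  by rewrite normrM normrX ler_wpM2l// ler_weXn2l// ltnW.
pose c := (M + B) * L ^+ (d * 2).
have c0 : 0 <= c by rewrite mulr_ge0 ?addr_ge0// exprn_ge0.
have [q cq] : exists q, c * (L / K) ^+ (q * 2) <= e.
  have LK : `|L / K| < 1.
    by rewrite ger0_norm ?divr_ge0 ?(ltW K0)// ltr_pdivrMr// mul1r ltrDl.
  have : c * (L / K) ^+ q @[q --> \oo] --> 0.
    by rewrite -[X in _ --> X](mulr0 c); apply: cvgMr; exact: cvg_expr.
  move=> /cvgrPdist_le/(_ e e0)[N _ HN]; exists N.
  have := HN (N * 2)%N; rewrite /= leq_pmulr// => /(_ isT).
  rewrite sub0r normrN => H; rewrite (le_trans (ler_norm _) H)//.
exists p, (((M + B) / K ^+ (q * 2)) *: 'X^((d + q) * 2)).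
have a0 : 0 <= (M + B) / K ^+ (q * 2).
  by rewrite divr_ge0 ?addr_ge0// exprn_ge0// ltW.
split=> [x|x|].
- rewrite hornerZ hornerXn.
  have [xK|xK] := leP `|x| K.
    rewrite (le_trans (fp x _))//; first by rewrite -ler_norml.
    by rewrite lerDl mulr_ge0// exprM sqr_ge0.
  have x1 : 1 <= `|x| by rewrite (le_trans K1)// ltW.
  rewrite ler_wpDl ?(ltW e0)// (le_trans (ler_normB _ _))//.
  apply: (@le_trans _ _ ((M + B) * `|x| ^+ (d * 2))).
    rewrite mulrDl lerD//.
      by rewrite (le_trans (fM x))// ler_peMr// exprn_ege1.
    rewrite (le_trans (pB x x1))// ler_wpM2l// ler_weXn2l// leq_pmulr//.
  rewrite mulnDl exprD mulrACA.
  have evn k : x ^+ (k * 2) = `|x| ^+ (k * 2).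
    by rewrite [LHS]exprM [RHS]exprM -normrX real_normK ?num_real.
  rewrite !evn.
  apply: ler_peMr; first by rewrite mulr_ge0 ?addr_ge0// exprn_ge0.
  rewrite [leRHS]mulrC ler_pdivlMr ?exprn_gt0// mul1r lerXn2r ?nnegrE//; exact: ltW.
- by rewrite hornerZ hornerXn mulr_ge0// exprM sqr_ge0.
rewrite (le_trans (ler_norm _))// (@le_trans _ _ (c * (L / K) ^+ (q * 2)))//.
apply: density_mean_bound => // x /andP[x0 xL].
rewrite hornerZ hornerXn normrM (ger0_norm a0) normrX (ger0_norm x0).
have -> : c * (L / K) ^+ (q * 2) = (M + B) / K ^+ (q * 2) * L ^+ ((d + q) * 2).
  by rewrite /c mulnDl exprD exprMn exprVn; ring.
by rewrite ler_wpM2l// lerXn2r.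
Qed.

(** By [poly_sandwich] it suffices to know the limits for the two
    polynomials [p] and [r]. *)
Theorem average_cvg (f : R -> R) M : continuous f -> (forall x, `|f x| <= M) ->
  average (s_ n) f @[n --> \oo] --> density_mean f.
Proof.
move=> cf fM; apply/cvgrPdist_le => e e0.
have e60 : 0 < e / 6 by rewrite divr_gt0.
have [p [r [fp r0 re]]] := poly_sandwich cf fM e60.
have mf : measurable_fun setT f by exact: continuous_measurable_fun.
have := @average_poly_cvg p => /cvgrPdist_le/(_ _ e60) Hp.
have := @average_poly_cvg r => /cvgrPdist_le/(_ _ e60) Hr.
near=> n.
have Hpn : `|density_mean (horner p) - average (s_ n) (horner p)| <= e / 6 by near: n.
have Hrn : `|density_mean (horner r) - average (s_ n) (horner r)| <= e / 6 by near: n.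
have n0 : (0 < n)%N by near: n; exact: nbhs_infty_gt.
have d1 : `|average (s_ n) f - average (s_ n) (horner p)| <= e / 6 + (e / 6 + e / 6).
  have -> : average (s_ n) f - average (s_ n) (horner p) =
      average (s_ n) (fun x => f x - p.[x]).
    rewrite -mulN1r -averageZ -averageD; congr average.
    by apply/funext => x; rewrite mulN1r.
  rewrite (le_trans (norm_average _ fp))// averageD average_cst ?size_s// lerD2l.
  rewrite -[average _ _](subrK (density_mean (horner r))) lerD//.
  by rewrite (le_trans (ler_norm _))// distrC.
have d2 : `|density_mean f - density_mean (horner p)| <= e / 6 + e / 6.
  have [C pC] := horner_bound p; have [C' rC] := horner_bound r.
  have [D fpD] := bounded_sub p fM.
  have ip := integrable_density_mean (measurable_horner p) pC.
  have ir := integrable_density_mean (measurable_horner r) rC.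
  have if_ := integrable_density_mean mf (fun x _ => fM x).
  rewrite /density_mean -RintegralB//.
  have mfp : measurable_fun setT (fun x => f x - p.[x]) by exact: measurable_funB.
  have ifp : mu.-integrable setT (fun x => (f x * Y x - p.[x] * Y x)%:E).
    exact: (integrableB measurableT if_ ip).
  rewrite (le_trans (le_normr_Rintegral measurableT ifp))//.
  have ie : mu.-integrable setT (fun x => (e / 6 * Y x)%:E) by exact: iYC.
  apply: (@le_trans _ _ (\int[mu]_x (e / 6 * Y x + r.[x] * Y x))).
    apply: le_Rintegral => //.
    - exact: integrable_norm ifp.
    - exact: (integrableD measurableT ie ir).
    by move=> x _; rewrite -mulrBl normrM (ger0_norm (Y0 x)) -mulrDl ler_wpM2r.
  by rewrite RintegralD// RintegralZl// Y1 mulr1 lerD2l.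
rewrite distrC in Hpn.
have -> : density_mean f - average (s_ n) f = (density_mean f - density_mean (horner p)) -
  (average (s_ n) (horner p) - density_mean (horner p)) -
  (average (s_ n) f - average (s_ n) (horner p)) by ring.
rewrite (le_trans (ler_normB _ _))// (le_trans (lerD (ler_normB _ _) d1))//.
by move: Hpn d2; lra.
Unshelve. all: by end_near. Qed.

End moment_method.

(** * Moments of the limit law *)

Section catalan.
Variables (R : numFieldType) (c : R) (b : nat -> R).
Hypothesis b0 : b 0 = 1.
Hypothesis bS : forall k, k.+2%:R * b k.+1 = c * (4 * k + 2)%:R * b k.

(** Let [S n] be the sum of the [b l * b (n - l)]. Since [l] and [n - l]
    play symmetric roles, the sum [T n] with weights [l.+1] equals [n.+2%:R
    / 2 * S n]. Applying [bS] to the terms of [T n.+1] then expresses [S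
    n.+1] through [S n]. *)
Lemma catalan_convolution k : b k.+1 = c * \sum_(l < k.+1) b l * b (k - l).
Proof.
pose S n := \sum_(l < n.+1) b l * b (n - l)%N.
pose T n := \sum_(l < n.+1) l.+1%:R * b l * b (n - l)%N.
have TE n : 2 * T n = n.+2%:R * S n.
  have Trev : T n = \sum_(l < n.+1) (n - l).+1%:R * b l * b (n - l)%N.
    rewrite /T (reindex_inj rev_ord_inj) /=; apply: eq_bigr => l _.
    have ln : (l <= n)%N by rewrite -ltnS.
    by rewrite subSS subKn//; ring.
  rewrite mulr_natl mulr2n {2}Trev -big_split mulr_sumr; apply: eq_bigr => l _ /=.
  have ln : (l <= n)%N by rewrite -ltnS.
  have -> : n.+2%:R = l.+1%:R + (n - l).+1%:R :> R.
    by rewrite -natrD addnS addSn subnKC.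
  by ring.
have TS n : T n.+1 = b n.+1 + c * (2 * n.+1)%:R * S n.
  rewrite /T big_ord_recl /= mul1r b0 mul1r subn0; congr (_ + _).
  have -> : c * (2 * n.+1)%:R * S n = c * (4 * T n - 2 * S n).
    have -> : 4 * T n = 2 * (2 * T n) by ring.
    by rewrite TE natrM -[n.+2%:R]natr1; ring.
  rewrite /T /S !mulr_sumr -sumrB mulr_sumr; apply: eq_bigr => l _ /=.
  by rewrite /bump /= add1n subSS bS natrD natrM -[l.+1%:R]natr1; ring.
elim: k => [|k IH].
  by apply: (mulfI (x := 2)); rewrite ?pnatr_eq0// bS big_ord1 subnn b0; ring.
rewrite -/(S k.+1).
apply: (mulfI (x := k.+3%:R)); first by rewrite pnatr_eq0.
rewrite bS mulrCA -TE TS; have {}IH : c * S k = b k.+1 by rewrite IH.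
rewrite -mulrA mulrCA -[c * (2 * _)%:R * _]mulrA [c * ((2 * _)%:R * _)]mulrCA IH.
by rewrite natrD !natrM -[k.+1%:R]natr1; ring.
Qed.

End catalan.

Section laguerre_moments.
Context {R : realType}.
Notation mu := lebesgue_measure.
Variable b : R.
Hypothesis b_gt0 : 0 < b.

Let t x := Num.sqrt ((b - x) / x).

Let is_derive_t x : 0 < x < b -> is_derive x (1 : R) t (- b / (2 * x ^+ 2 * t x)).
Proof.
move=> /andP[x0 xb]; have xn0 : x != 0 by rewrite gt_eqF.
have ux : 0 < (b - x) / x by rewrite divr_gt0// subr_gt0.
have du : is_derive x (1 : R) (fun y => (b - y) / y) (- b / x ^+ 2).
  have dV : is_derive x (1 : R) (fun y : R => y^-1) (- x ^- 2 *: 1).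
    by apply: (@is_deriveV _ id).
  rewrite (_ : (fun y => _) = (cst b - id) * (fun y : R => y^-1)); last by apply/funext.
  apply: is_derive_eq; rewrite /GRing.scale /= !fctE; field.
  by [].
have ds := is_derive1_sqrt ux.
have := @is_derive1_comp _ Num.sqrt (fun y => (b - y) / y) x _ _ ds du.
rewrite -[Num.sqrt \o _]/t => /is_derive_eq; apply.
rewrite -/(t x); field; rewrite xn0 /= gt_eqF// sqrtr_gt0//.
Qed.

Let t2 x : 0 < x <= b -> t x ^+ 2 = (b - x) / x.
Proof.
move=> /andP[x0 xb]; rewrite sqr_sqrtr// divr_ge0 ?subr_ge0// ltW//.
Qed.

(** An antiderivative of [t]: as [x = b / (1 + t x ^+ 2)], it is found by
    integrating [x] against [t] instead. *)
Let F x := x * t x - b * atan (t x).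

Let is_derive_F x : 0 < x < b -> is_derive x (1 : R) F (t x).
Proof.
move=> xb; have dt := is_derive_t xb; case/andP: xb => x0 xb.
have tx0 : t x != 0 by rewrite gt_eqF// sqrtr_gt0 divr_gt0// subr_gt0.
have xn0 : x != 0 by rewrite gt_eqF.
have da := @is_derive1_comp _ atan t x _ _ (is_derive1_atan (t x)) dt.
rewrite (_ : F = id * t - b \*: (atan \o t)); last by apply/funext.
apply: is_derive_eq.
rewrite /GRing.scale /= t2 ?x0 ?ltW// mulr1.
field.
by rewrite xn0 tx0 /= addrC subrK gt_eqF.
Qed.

(** Equal to x^(k + 1/2) * (b - x)^(3/2), which vanishes at both ends of the
    interval. *)
Let G k x := x ^+ k.+1 * (b - x) * t x.

Let g k x := x ^+ k * t x * ((k%:R + 2^-1) * b - k.+2%:R * x).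

Let is_derive_G k x : 0 < x < b -> is_derive x (1 : R) (G k) (g k x).
Proof.
move=> xb; have dt := is_derive_t xb; case/andP: xb => x0 xb.
have tx0 : t x != 0 by rewrite gt_eqF// sqrtr_gt0 divr_gt0// subr_gt0.
have xn0 : x != 0 by rewrite gt_eqF.
rewrite (_ : G k = id ^+ k.+1 * (cst b - id) * t); last first.
  by apply/funext => y; rewrite /G !fctE.
apply: is_derive_eq.
rewrite /GRing.scale /= !fctE /g.
have tt : b - x = x * t x ^+ 2.
  by rewrite t2 ?x0 ?ltW//; field.
have -> : - b / (2 * x ^+ 2 * t x) = - b * t x / (2 * x * (b - x)).
  by rewrite tt; field; rewrite xn0 tx0.
rewrite exprS -[k.+2%:R]natr1 -[k.+1%:R]natr1; move: (x ^+ k) => y; field.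
by rewrite xn0 /= subr_eq0 gt_eqF.
Qed.

Let t_continuous x : 0 < x -> {for x, continuous t}.
Proof.
move=> x0; apply: (@continuous_comp _ _ _ (fun y => (b - y) / y) Num.sqrt).
  apply: cvgM; first by apply: cvgB; [exact: cvg_cst|exact: cvg_id].
  by apply: inv_continuous; rewrite gt_eqF.
exact: sqrt_continuous.
Qed.

Let FTC_t (H h : R -> R) e : 0 < e < b ->
  (forall x, 0 < x -> {for x, continuous H}) ->
  (forall x, 0 < x -> {for x, continuous h}) ->
  (forall x, 0 < x < b -> is_derive x (1 : R) H (h x)) ->
  (\int[mu]_(x in `[e, b]) (h x)%:E = (H b)%:E - (H e)%:E)%E.
Proof.
move=> /andP[e0 eb] cH ch dH.
apply: continuous_FTC2 => //.
- apply: continuous_in_subspaceT => x; rewrite inE /= in_itv /= => /andP[ex _].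
  by apply: ch; exact: lt_le_trans ex.
- split.
  + move=> x; rewrite in_itv /= => /andP[ex xb].
    by have [] := dH x; rewrite ?xb ?(lt_trans e0).
  + by apply: cvg_at_right_filter; exact: cH.
  + by apply: cvg_at_left_filter; exact: cH.
- move=> x; rewrite in_itv /= => /andP[ex xb].
  by rewrite derive1E; have [] := dH x; rewrite ?xb ?(lt_trans e0).
Qed.
(** The integrals are first taken over [[e_ n, b]] because [t] is singular
    at the origin. *)
Let e_ (n : nat) : R := b / n.+2%:R.

Let e_bnd n : 0 < e_ n < b.
Proof. by rewrite divr_gt0//= ltr_pdivrMr// ltr_pMr// ltr1n. Qed.

Let e_cvg : e_ n @[n --> \oo] --> 0.
Proof.
rewrite -[X in _ --> X](mulr0 b); apply: cvgMr.
by have := @cvg_harmonic R; rewrite -(cvg_shiftS (@harmonic R)).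
Qed.

Let t_e n : t (e_ n) = Num.sqrt n.+1%:R.
Proof.
rewrite /t /e_; congr Num.sqrt.
have -> : n.+1%:R = n.+2%:R - 1 :> R by rewrite -[n.+2%:R]natr1 addrK.
have : n.+2%:R != 0 :> R by rewrite pnatr_eq0.
by move: n.+2%:R => N N0; field; rewrite N0 gt_eqF.
Qed.

Let t_b : t b = 0.
Proof. by rewrite /t subrr mul0r sqrtr0. Qed.

Let et_cvg : e_ n * t (e_ n) @[n --> \oo] --> 0.
Proof.
rewrite (_ : (fun n => _) = (fun n => Num.sqrt (e_ n * (b - e_ n)))).
  rewrite -[X in _ --> X]sqrtr0; apply: continuous_cvg; first exact: sqrt_continuous.
  rewrite -[X in _ --> X](mul0r (b - 0)); apply: cvgM => //.
  by apply: cvgB; [exact: cvg_cst|exact: e_cvg].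
apply/funext => n; have /andP[e0 eb] := e_bnd n.
rewrite -{1}[e_ n]gtr0_norm// -sqrtr_sqr -sqrtrM ?sqr_ge0//; congr Num.sqrt.
by field; rewrite gt_eqF.
Qed.

Let atan_cvg : atan (t (e_ n)) @[n --> \oo] --> pi / 2.
Proof.
have sqrty : (fun n : nat => Num.sqrt n.+1%:R : R) @ \oo --> +oo.
  apply/cvgryPge => A; near=> n.
  have nA : A ^+ 2 <= n.+1%:R.
    near: n; exists (Num.truncn (A ^+ 2)) => // n /= nA.
    by rewrite (le_trans (ltW (truncnS_gt _)))// ler_nat ltnS.
  by rewrite (le_trans (ler_norm A))// -sqrtr_sqr ler_sqrt.
under eq_fun do rewrite t_e.
exact: (cvg_comp _ _ sqrty (@cvgy_atan R)).
Unshelve. all: by end_near. Qed.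

Let tb x : R := if 0 <= x <= b then t x else 0.

Let tb_ge0 x : 0 <= tb x.
Proof. by rewrite /tb; case: ifP => // _; exact: sqrtr_ge0. Qed.

Let tb0 : tb 0 = 0.
Proof. by rewrite /tb lexx /= ltW// /t invr0 mulr0 sqrtr0. Qed.

Let I_ n : set R := `[e_ n, b]%classic.

Let I_tb x : tb x != 0 -> \forall n \near \oo, I_ n x.
Proof.
move=> tbx; have [x0 xb] : 0 < x /\ x <= b.
  move: tbx; rewrite lt_def; have [->|xn0 tbx] := eqVneq x 0; first by rewrite tb0 eqxx.
  by move: tbx; rewrite /tb; case: ifPn => [/andP[-> ->]//|]; rewrite eqxx.
have H : \forall n \near \oo, e_ n < x by apply: (cvgr_lt _ e_cvg).
near=> n; have en : e_ n < x by near: n.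
by rewrite /I_ /= in_itv /= ltW.
Unshelve. all: by end_near. Qed.

Let integral_tb_I n : (\int[mu]_(x in I_ n) (tb x)%:E =
  (b * atan (t (e_ n)) - e_ n * t (e_ n))%:E)%E.
Proof.
have [e0 eb] : 0 < e_ n /\ e_ n < b by apply/andP.
transitivity (\int[mu]_(x in I_ n) (t x)%:E)%E.
  apply: eq_integral => x; rewrite inE /I_ /= in_itv /= => /andP[ex xb].
  by rewrite /tb xb (le_trans (ltW e0) ex).
have cF x : 0 < x -> {for x, continuous F}.
  move=> x0; apply: cvgB.
    by apply: cvgM; [exact: cvg_id|exact: t_continuous].
  apply: cvgM; first exact: cvg_cst.
  by apply: continuous_comp; [exact: t_continuous|exact: continuous_atan].
rewrite (@FTC_t F t _ (e_bnd n) cF (fun x => @t_continuous x) (fun x => @is_derive_F x)).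
by rewrite -EFinB /F t_b atan0 !mulr0 subrr sub0r opprB.
Qed.

Let mtb : measurable_fun setT tb.
Proof.
rewrite (_ : tb = fun x => t x * \1_(`[0, b]%classic : set R) x); last first.
  apply/funext => x; rewrite /tb indicE mem_setE in_itv /=.
  by case: ifP; rewrite (mulr1, mulr0).
apply: measurable_funM; last exact: measurable_indic.
apply: measurableT_comp => /=.
  by apply: continuous_measurable_fun; exact: sqrt_continuous.
apply: measurable_funM; first exact: measurable_funB.
have -> : setT = [set 0 : R] `|` ~` [set 0] by rewrite setUv.
apply/measurable_funU => //; first exact: measurableC.
split; first exact: measurable_fun_set1.
apply: open_continuous_measurable_fun; first by apply: closed_openC; exact: closed_eq.
by move=> x /set_mem/eqP x0; exact: inv_continuous.
Qed.

Let integral_tb : (\int[mu]_x (tb x)%:E = (b * (pi / 2))%:E)%E.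
Proof.
pose gn n : R -> \bar R := (EFin \o tb) \_ (I_ n).
have mI n : measurable (I_ n) by exact: measurable_itv.
have gE n : (\int[mu]_x gn n x = (b * atan (t (e_ n)) - e_ n * t (e_ n))%:E)%E.
  by rewrite -integral_mkcond integral_tb_I.
have gcvg x : gn ^~ x @ \oo --> (tb x)%:E.
  have [tx0|tx0] := eqVneq (tb x) 0.
    rewrite (_ : gn ^~ x = fun=> 0%E) ?tx0; first exact: cvg_cst.
    by apply/funext => n; rewrite /gn patchE /= tx0; case: ifP.
  apply: cvg_near_cst; near=> n.
  rewrite /gn patchE ifT// inE; near: n; exact: I_tb.
have mg n : measurable_fun setT (gn n).
  apply/(measurable_restrictT _ (mI n)); apply: measurable_funTS.
  by apply/measurable_EFinP; exact: mtb.
have := @cvg_monotone_convergence _ _ _ mu setT measurableT gn mg.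
have g0 n x : setT x -> (0 <= gn n x)%E.
  by move=> _; rewrite /gn patchE; case: ifP => //; rewrite lee_fin tb_ge0.
have ndg x : setT x -> nondecreasing_seq (gn ^~ x).
  move=> _ n m nm; rewrite /gn !patchE; case: ifPn => [|_]; last first.
    by case: ifP => //; rewrite lee_fin tb_ge0.
  rewrite inE /I_ /= in_itv /= => /andP[ex xb]; rewrite ifT// inE /I_ /= in_itv /= xb andbT.
  by rewrite (le_trans _ ex)// /e_ ler_pM2l// lef_pV2 ?posrE// ler_nat.
move=> /(_ g0 ndg) cv.
have cv2 : (fun n => \int[mu]_x gn n x)%E @ \oo --> (b * (pi / 2))%:E.
  under eq_fun do rewrite gE.
  apply: cvg_EFin; first exact: nearW.
  rewrite -[X in _ --> X]subr0; apply: cvgB; last exact: et_cvg.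
  by apply: cvgMr; exact: atan_cvg.
rewrite (cvg_unique _ cv2 cv)//; apply: eq_integral => x _.
by apply/esym/cvg_lim.
Unshelve. all: by end_near. Qed.

Let integrable_tb : mu.-integrable setT (EFin \o tb).
Proof.
apply/integrableP; split; first exact/measurable_EFinP.
under eq_integral do rewrite /= ger0_norm//.
by rewrite integral_tb ltry.
Qed.

Let gb k x := x ^+ k * tb x * ((k%:R + 2^-1) * b - k.+2%:R * x).

Let integrable_pow_tb k : mu.-integrable setT (fun x => (x ^+ k * tb x)%:E).
Proof.
have ib : mu.-integrable setT (fun x => (b ^+ k * tb x)%:E).
  by have := integrableZl measurableT (b ^+ k) integrable_tb.
apply: le_integrable ib => //.
  by apply/measurable_EFinP; apply: measurable_funM => //; exact: measurable_funX.
move=> x _; rewrite lee_fin !normrM (ger0_norm (tb_ge0 x)) /tb.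
case: ifPn => [/andP[x0 xb]|_]; last by rewrite !mulr0.
rewrite ler_wpM2r ?sqrtr_ge0// !normrX lerXn2r ?nnegrE//.
by rewrite !ger0_norm// ltW.
Qed.

Let gbE k : gb k = fun x => (k%:R + 2^-1) * b * (x ^+ k * tb x) -
  k.+2%:R * (x ^+ k.+1 * tb x).
Proof. by apply/funext => x; rewrite /gb exprS; ring. Qed.

Let integrable_Zpow_tb k c : mu.-integrable setT (fun x => (c * (x ^+ k * tb x))%:E).
Proof. exact: (integrableZl measurableT c (integrable_pow_tb k)). Qed.

Let integrable_gb k : mu.-integrable setT (EFin \o gb k).
Proof.
rewrite gbE; exact: (integrableB measurableT (integrable_Zpow_tb k _)
  (integrable_Zpow_tb k.+1 _)).
Qed.

Let integral_gb k : (\int[mu]_x (gb k x)%:E = 0)%E.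
Proof.
have gI x : gb k x != 0 -> \forall n \near \oo, I_ n x.
  move=> gx; apply: I_tb; apply: contraNneq gx => tx.
  by rewrite /gb tx mulr0 mul0r.
have cv := @integral_exhaust _ _ _ (integrable_gb k) (fun n => measurable_itv _) gI.
have E n : (\int[mu]_(x in I_ n) (gb k x)%:E = (- (e_ n ^+ k * (b - e_ n) * (e_ n * t (e_ n))))%:E)%E.
  have [e0 eb] : 0 < e_ n /\ e_ n < b by apply/andP.
  transitivity (\int[mu]_(x in I_ n) (g k x)%:E)%E.
    apply: eq_integral => x; rewrite inE /I_ /= in_itv /= => /andP[ex xb].
    by rewrite /gb /g /tb xb (le_trans (ltW e0) ex).
  have cX j x : {for x, continuous (fun y : R => y ^+ j)}.
    exact: exprn_continuous.
  have cG x : 0 < x -> {for x, continuous (G k)}.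
    move=> x0; apply: cvgM; last exact: t_continuous.
    apply: cvgM; first exact: cX.
    by apply: cvgB; [exact: cvg_cst|exact: cvg_id].
  have cg x : 0 < x -> {for x, continuous (g k)}.
    move=> x0; apply: cvgM.
      by apply: cvgM; [exact: cX|exact: t_continuous].
    by apply: cvgB; [exact: cvg_cst|apply: cvgM; [exact: cvg_cst|exact: cvg_id]].
  rewrite (@FTC_t (G k) (g k) _ (e_bnd n) cG cg (fun x => @is_derive_G k x)).
  by rewrite -EFinB /G subrr mulr0 mul0r sub0r exprS; congr EFin; ring.
have cv0 : (\int[mu]_(x in I_ n) (gb k x)%:E @[n --> \oo] --> 0)%E.
  under eq_fun do rewrite E.
  apply: cvg_EFin; first exact: nearW.
  rewrite -[X in _ --> X]oppr0; apply: cvgN.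
  rewrite -[X in _ --> X](mulr0 (0 ^+ k * (b - 0))); apply: cvgM; last exact: et_cvg.
  apply: cvgM; first by apply: (cvg_comp _ _ e_cvg (@exprn_continuous _ k 0)).
  by apply: cvgB; [exact: cvg_cst|exact: e_cvg].
exact: cvg_unique cv cv0.
Qed.

(** The density of [laguerre_law a] for [b = 8 * a ^+ 2]. *)
Definition mp_density (x : R) : R := (b * (pi / 2))^-1 * tb x.

Lemma mp_density_ge0 x : 0 <= mp_density x.
Proof. by rewrite mulr_ge0// invr_ge0 mulr_ge0 ?(ltW b_gt0)// divr_ge0// pi_ge0. Qed.

Lemma measurable_mp_density : measurable_fun setT mp_density.
Proof. exact: measurable_funM. Qed.

Lemma integrable_mp_density : mu.-integrable setT (EFin \o mp_density).
Proof. exact: (integrableZl measurableT _ integrable_tb). Qed.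

Let bpi : b * (pi / 2) != 0.
Proof. by rewrite !mulf_neq0 ?gt_eqF ?pi_gt0// invr_gt0. Qed.

Lemma integral_mp_density : \int[mu]_x mp_density x = 1.
Proof. by rewrite RintegralZl// /Rintegral integral_tb /= mulVf. Qed.

Lemma mp_density_support x : ~~ (0 <= x <= b) -> mp_density x = 0.
Proof. by rewrite /mp_density /tb => /negbTE ->; rewrite mulr0. Qed.

Lemma mp_densityE x : 0 <= x <= b ->
  mp_density x = (b * (pi / 2))^-1 * Num.sqrt ((b - x) / x).
Proof. by rewrite /mp_density /tb => ->. Qed.

Lemma mp_momentS k : k.+2%:R * density_mean mp_density (fun x => x ^+ k.+1) =
  b / 4 * (4 * k + 2)%:R * density_mean mp_density (fun x => x ^+ k).
Proof.
have dE j : density_mean mp_density (fun x => x ^+ j) =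
    (b * (pi / 2))^-1 * \int[mu]_x (x ^+ j * tb x).
  rewrite /density_mean -RintegralZl//; first by apply: eq_Rintegral => x _; rewrite mulrCA.
  exact: integrable_pow_tb.
have : \int[mu]_x gb k x = 0 by rewrite /Rintegral integral_gb.
rewrite gbE RintegralB//; [|exact: integrable_Zpow_tb..].
rewrite !RintegralZl//; [|exact: integrable_pow_tb..].
move/eqP; rewrite subr_eq0 => /eqP H.
by rewrite !dE mulrCA -H natrD natrM; move: (b * (pi / 2))^-1 => K; field.
Qed.

End laguerre_moments.

(** * Spectra of Hermitian matrices *)

Section hermitian_eigenvalues.
Local Open Scope sesquilinear_scope.
Context {C : numClosedFieldType} {n : nat}.
Variable M : 'M[C]_n.
Hypothesis M_herm : M^t* = M.

Let M_hermsymmx : M \is hermsymmx.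
Proof. by apply/is_hermitianmxP; rewrite expr0 scale1r M_herm. Qed.

Let diag_eq : M = invmx (spectralmx M) *m diag_mx (spectral_diag M) *m spectralmx M.
Proof. exact/orthomx_spectralP/hermitian_normalmx. Qed.

Let Pu : spectralmx M \in unitmx. Proof. exact: spectral_unit. Qed.

Lemma perm_eigenvalues_spectral_diag :
  perm_eq (eigenvalues M) [seq spectral_diag M ord0 i | i <- enum 'I_n].
Proof.
apply: prod_XsubC_eq; rewrite -char_poly_eigenvalues big_map big_enum /=.
have -> : char_poly M = char_poly (diag_mx (spectral_diag M)).
  set Q := spectralmx M; set D := diag_mx _.
  rewrite /char_poly /char_poly_mx.
  have XQ : ('X%:M : 'M[{poly C}]_n) = map_mx polyC (invmx Q) *m 'X%:M *m map_mx polyC Q.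
    by rewrite scalar_mxC -mulmxA -map_mxM mulVmx// map_mx1 mulmx1.
  rewrite {1}diag_eq !map_mxM {1}XQ -mulmxBl -mulmxBr !det_mulmx mulrAC.
  by rewrite -det_mulmx -map_mxM mulVmx// map_mx1 det1 mul1r.
rewrite char_poly_trig.
  by apply: eq_bigr => i _; rewrite mxE eqxx mulr1n.
exact: diag_mx_is_trig.
Qed.

Lemma eigenvalues_real z : z \in eigenvalues M -> z \is Num.real.
Proof.
rewrite (perm_mem perm_eigenvalues_spectral_diag) => /mapP[i _ ->].
exact: (mxOverP (hermitian_spectral_diag_real M_hermsymmx)).
Qed.

Lemma trace_exp_eigenvalues k : \tr (M ^+ k) = \sum_(z <- eigenvalues M) z ^+ k.
Proof.
have diagX j (d : 'rV[C]_n) : diag_mx d ^+ j = diag_mx (\row_i (d ord0 i ^+ j)).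
  elim: j => [|j IH].
    rewrite expr0; apply/matrixP => i l; rewrite !mxE expr0.
    by case: eqP.
  rewrite exprS IH -[_ * _]/(_ *m _) mulmx_diag; congr diag_mx.
  by apply/rowP => i; rewrite !mxE exprS.
have -> : M ^+ k = invmx (spectralmx M) *m diag_mx (spectral_diag M) ^+ k *m spectralmx M.
  elim: k => [|k IH]; first by rewrite !expr0 mulmx1 mulVmx.
  rewrite exprS IH {1}diag_eq -[_ * _]/(_ *m _) exprS -[_ * _ ^+ k]/(_ *m _).
  by rewrite !mulmxA mulmxK// -!mulmxA.
rewrite mxtrace_mulC mulmxA mulmxV// mul1mx diagX mxtrace_diag.
rewrite (perm_big _ perm_eigenvalues_spectral_diag) big_map big_enum /=.
by apply: eq_bigr => i _; rewrite mxE.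
Qed.

End hermitian_eigenvalues.

(** * Integrals against the spectral measure and the limit law *)

Section integrals.
Context {R : realType}.
Notation mu := lebesgue_measure.

Lemma integral_eigencount n (M : 'M[R[i]]_n) (f : R -> R) :
  measurable_fun setT f ->
  (\int[eigencount M]_x (f x)%:E)%E =
  (average [seq complex.Re z | z <- eigenvalues M] f)%:E.
Proof.
move=> mf; pose s := [seq complex.Re z | z <- eigenvalues M].
have ss : size s = n by rewrite size_map size_eigenvalues.
have n0 : 0 <= n%:R^-1 :> R by rewrite invr_ge0.
pose m : {measure set R -> \bar R} := mscale (NngNum n0) (msum (fun k => dirac (nth 0 s k) : {measure set R -> \bar R}) n).
have mE D : measurable D -> eigencount M D = m D.
  move=> _; rewrite /eigencount /m /mscale /msum EFinM; congr (_ * _)%E.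
  transitivity (\sum_(x <- s) (dirac x D : \bar R))%E; last by rewrite (big_nth 0) ss big_mkord.
  rewrite /s big_map; elim: (eigenvalues M) => [|z r IH] /=; first by rewrite big_nil.
  by rewrite big_cons -IH natrD EFinD diracE.
have ge0 (g : R -> \bar R) : measurable_fun setT g -> (forall x, 0 <= g x)%E ->
    (\int[eigencount M]_x g x = n%:R^-1%:E * \sum_(x <- s) g x)%E.
  move=> mg g0; rewrite (eq_measure_integral m)//; last by move=> D mD _; rewrite /= mE.
  rewrite ge0_integral_mscale//= ge0_integral_measure_sum//; congr (_ * _)%E.
  transitivity (\sum_(k < n) g (nth 0%R s k))%E.
    by apply: eq_bigr => k _; rewrite integral_dirac// diracT mul1e.
  by rewrite (big_nth 0) ss big_mkord.
have mEf : measurable_fun setT (EFin \o f) by exact/measurable_EFinP.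
rewrite integralE (ge0 ((EFin \o f)^\+)%E)//; last exact: measurable_funepos.
rewrite (ge0 ((EFin \o f)^\-)%E)//; last exact: measurable_funeneg.
have pE (x : R) : ((EFin \o f)^\+ x = (Num.max (f x) 0)%:E)%E by rewrite funeposE EFin_max.
have nE (x : R) : ((EFin \o f)^\- x = (Num.max (- f x) 0)%:E)%E by rewrite funenegE EFin_max.
under eq_bigr do rewrite pE; under [X in (_ - _ * X)%E]eq_bigr do rewrite nE.
rewrite !sumEFin -!EFinM -EFinB /average -/s ss -mulrBr -sumrB; congr (_ * _)%:E.
apply: eq_bigr => x _; rewrite !maxEle; case: (leP (f x) 0) => fx.
  rewrite oppr_le0; case: leP => fx2; last by rewrite sub0r opprK.
  by apply/eqP; rewrite subrr eq_le fx fx2.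
by rewrite oppr_le0 ltW// subr0.
Qed.

Lemma integral_laguerre_law (a : R) (f : R -> R) : 0 < a ->
  measurable_fun setT f ->
  (\int[laguerre_law a]_x (f x)%:E)%E =
  (\int[mu]_x (f x * mp_density (8 * a ^+ 2) x)%:E)%E.
Proof.
move=> a0 mf; have b0 : 0 < 8 * a ^+ 2 by rewrite mulr_gt0// exprn_gt0.
apply/esym; apply: (@integral_weighted_pushforward _ _ _ _ _ mu (laguerre_law a) id
  (mp_density (8 * a ^+ 2))) => //.
- exact: measurable_mp_density.
- exact: mp_density_ge0.
move=> D mD.
have c0 : 0 <= (4 * pi * a ^+ 2)^-1 by rewrite invr_ge0 mulr_ge0 ?sqr_ge0 ?mulr_ge0 ?pi_ge0.
have mdens : measurable_fun (D `&` `[0, 8 * a ^+ 2]%classic)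
    (fun x => (Num.sqrt ((8 * a ^+ 2 - x) / x))%:E).
  apply: (eq_measurable_fun
    (fun x => (8 * a ^+ 2 * (pi / 2) * mp_density (8 * a ^+ 2) x)%:E)).
    move=> x; rewrite inE => -[_]; rewrite /= in_itv /= => xb.
    rewrite mp_densityE// mulVKf//.
    by rewrite mulf_neq0 ?gt_eqF ?divr_gt0 ?pi_gt0.
  apply: measurable_funTS; apply/measurable_EFinP; apply: measurable_funM => //.
  exact: measurable_mp_density.
transitivity ((4 * pi * a ^+ 2)^-1%:E *
  \int[mu]_(x in D `&` `[0%R, (8 * a ^+ 2)%R])
     (Num.sqrt ((8 * a ^+ 2 - x) / x))%:E)%E; last by [].
rewrite -ge0_integralZl//; last exact: measurableI.
rewrite integral_mkcondr; apply: eq_integral => x _.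
rewrite patchE mem_setE in_itv /=; case: ifPn => [xb|xb].
  rewrite mp_densityE// -EFinM; congr (_ * _)%:E; congr (_^-1).
  by move: pi => p; field.
by rewrite mp_density_support.
Qed.
End integrals.

(** * Expectations of polynomials in the random entries *)

Section centered_complex_gaussian.
Context {d : measure_display} {Omega : measurableType d} {R : realType}.
Variables (P : probability Omega R) (v : R) (X : Omega -> R[i]).
Hypothesis X_gauss : complex_gaussian P X.
Hypothesis EX : cexpectation P X = 0.
Hypothesis EX2 : cexpectation P (fun w => X w ^+ 2) = 0.
Hypothesis EnormX2 : cexpectation P (fun w => `|X w| ^+ 2) = (2 * v)%:C.

Let x w := cRe (X w).
Let y w := cIm (X w).

Let expectationE (f : Omega -> R) : fine 'E_P[f]%E = \int[P]_w f w.
Proof. by rewrite unlock. Qed.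

Let Ex : \int[P]_w x w = 0.
Proof. by move: EX; rewrite /cexpectation !expectationE => -[]. Qed.

Let Ey : \int[P]_w y w = 0.
Proof. by move: EX; rewrite /cexpectation !expectationE => -[]. Qed.

Let mx : measurable_fun setT x. Proof. by case: X_gauss => -[]. Qed.
Let my : measurable_fun setT y. Proof. by case: X_gauss => -[]. Qed.

Let gaussxy u w : exists m s : R, forall B : set R, measurable B ->
  P [set t | B (u * x t + w * y t)] = gaussian_law m s B.
Proof. by case: X_gauss => _; apply. Qed.

Lemma integrable_re_im_monomial j l :
  integrable_rv P (fun w => cRe (X w) ^+ j * cIm (X w) ^+ l).
Proof. exact: (integrable_mixed mx my gaussxy Ex Ey). Qed.

Let ixx : integrable_rv P (fun w => x w ^+ 2).
Proof.
by have := integrable_re_im_monomial 2 0; under eq_fun do rewrite expr0 mulr1.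
Qed.

Let iyy : integrable_rv P (fun w => y w ^+ 2).
Proof.
by have := integrable_re_im_monomial 0 2; under eq_fun do rewrite expr0 mul1r.
Qed.

Let ixy : integrable_rv P (fun w => x w * y w).
Proof. exact: (integrable_re_im_monomial 1 1). Qed.

Let Exx_sub : \int[P]_w x w ^+ 2 - \int[P]_w y w ^+ 2 = 0.
Proof.
move: EX2; rewrite /cexpectation !expectationE => -[+ _].
rewrite -RintegralB// => <-; apply: eq_Rintegral => w _.
by rewrite /x /y; case: (X w) => p q; rewrite expr2 /= -!expr2.
Qed.

Let Exy : \int[P]_w (x w * y w) = 0.
Proof.
move: EX2; rewrite /cexpectation !expectationE => -[_].
rewrite (_ : \int[P]_w _ = 2 * \int[P]_w (x w * y w)).
  by move/eqP; rewrite mulf_eq0 pnatr_eq0 => /eqP.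
rewrite -RintegralT_Z//; apply: eq_Rintegral => w _.
by rewrite /x /y; case: (X w) => p q; rewrite expr2 /=; ring.
Qed.

Let Exx_add : \int[P]_w x w ^+ 2 + \int[P]_w y w ^+ 2 = 2 * v.
Proof.
move: EnormX2; rewrite /cexpectation !expectationE => -[<- _].
rewrite -RintegralT_D//; apply: eq_Rintegral => w _.
rewrite mul0r subr0 /x /y; case: (X w) => p q /=.
by rewrite -[RHS]expr2 sqr_sqrtr // addr_ge0 // sqr_ge0.
Qed.

Lemma integral_re_im_monomial j l :
  \int[P]_w (cRe (X w) ^+ j * cIm (X w) ^+ l) = gauss_moment v j * gauss_moment v l.
Proof.
apply: (gaussian_mixed_moment mx my gaussxy Ex Ey) => //.
- by move: Exx_sub Exx_add; lra.
- by move: Exx_sub Exx_add; lra.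
Qed.

End centered_complex_gaussian.

Section laguerre_expectation.
Context {R : realType} {d : measure_display} {Omega : measurableType d}.
Variables (P : probability Omega R) (v : R) (A : nat -> nat -> Omega -> R[i]).
Hypothesis A_gauss : forall j k, complex_gaussian P (A j k).
Hypothesis A_indep : mutually_independent P (fun jk : nat * nat => A jk.1 jk.2).
Hypothesis EA : forall j k, cexpectation P (A j k) = 0.
Hypothesis EA2 : forall j k, cexpectation P (fun w => A j k w ^+ 2) = 0.
Hypothesis EnormA2 : forall j k,
  cexpectation P (fun w => `|A j k w| ^+ 2) = (2 * v)%:C.

Let Z (jk : nat * nat) (w : Omega) : R * R := (cRe (A jk.1 jk.2 w), cIm (A jk.1 jk.2 w)).

Let mZ jk : measurable_fun setT (Z jk).
Proof.
by case: (A_gauss jk.1 jk.2) => -[mx my] _; exact: measurable_fun_pair.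
Qed.

Let monomial (a : nat * nat) (z : R * R) : R := z.1 ^+ a.1 * z.2 ^+ a.2.

Let law_integrable_monomial a jk : law_integrable P Z (monomial a) jk.
Proof.
split.
  apply: measurable_funM; apply: measurable_funX.
    exact: measurable_fst.
  exact: measurable_snd.
exact: (integrable_re_im_monomial (A_gauss _ _) (EA _ _)).
Qed.

Let law_mean_monomial a jk : law_mean P Z (monomial a) jk = gauss_moment v a.1 * gauss_moment v a.2.
Proof.
have := integral_re_im_monomial (A_gauss jk.1 jk.2) (EA _ _) (EA2 _ _) (EnormA2 _ _).
by move=> /(_ a.1 a.2).
Qed.

Variable n : nat.

Definition entry_part (w : Omega) (t : entry_index n) : R :=
  if t.2 then cIm (A t.1.1 t.1.2 w) else cRe (A t.1.1 t.1.2 w).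

Let idx : seq (nat * nat) := [seq (val p.1, val p.2) | p <- index_enum ('I_n * 'I_n)%type].

Let uniq_idx : uniq idx.
Proof.
rewrite map_inj_uniq ?index_enum_uniq// => -[i j] [k l] [] /= ik jl.
by congr pair; exact: val_inj.
Qed.

Variable m : mpoly.multinom #|{: entry_index n}|.

(** The value [(0, 0)] is never reached on [idx]. *)
Let ex (jk : nat * nat) : nat * nat :=
  match insub jk.1, insub jk.2 with
  | Some i, Some j => (mpoly.fun_of_multinom m (enum_rank ((i, j, false) : entry_index n)),
                       mpoly.fun_of_multinom m (enum_rank ((i, j, true) : entry_index n)))
  | _, _ => (0, 0)%N
  end.

Let prod_coord (F : entry_index n -> R) : \prod_(t : entry_index n) F t =
  \prod_(p : 'I_n * 'I_n) (F (p, false) * F (p, true)).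
Proof.
transitivity (\prod_(p : 'I_n * 'I_n) \prod_(b : bool) F (p, b)).
  by rewrite pair_bigA; apply: eq_bigr => -[].
by apply: eq_bigr => p _; rewrite big_bool mulrC.
Qed.

Let prod_rank (G : 'I_#|{: entry_index n}| -> R) :
  \prod_i G i = \prod_(t : entry_index n) G (enum_rank t).
Proof. by rewrite (reindex _ (onW_bij _ (@enum_rank_bij _))). Qed.

Lemma entry_monomialE w :
  \prod_i entry_part w (enum_val i) ^+ mpoly.fun_of_multinom m i =
  \prod_(jk <- idx) monomial (ex jk) (Z jk w).
Proof.
rewrite prod_rank prod_coord big_map; apply: eq_bigr => -[i j] _.
by rewrite !enum_rankK /entry_part /monomial /ex /= !valK.
Qed.

Lemma integrable_entry_monomial : integrable_rv P (fun w =>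
  \prod_i entry_part w (enum_val i) ^+ mpoly.fun_of_multinom m i).
Proof.
under eq_fun do rewrite entry_monomialE.
exact: (integrable_prod mZ A_indep (fun jk => law_integrable_monomial (ex jk) jk) uniq_idx).
Qed.

Lemma integral_entry_monomial :
  \int[P]_w (\prod_i entry_part w (enum_val i) ^+ mpoly.fun_of_multinom m i) =
  \prod_i gauss_moment v (mpoly.fun_of_multinom m i).
Proof.
under eq_Rintegral do rewrite entry_monomialE.
rewrite /Rintegral (integral_prod mZ A_indep (fun jk => law_integrable_monomial (ex jk) jk) uniq_idx) /=.
rewrite prod_rank prod_coord big_map; apply: eq_bigr => -[i j] _.
by rewrite law_mean_monomial /ex /= !valK.
Qed.

End laguerre_expectation.

(** * Mean square deviation of the spectral moments *)

Section laguerre_variance.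
Local Open Scope sesquilinear_scope.
Context {R : realType} {d : measure_display} {Omega : measurableType d}.
Variables (P : probability Omega R) (v : R) (A : nat -> nat -> Omega -> R[i]).
Hypothesis A_gauss : forall j k, complex_gaussian P (A j k).
Hypothesis A_indep : mutually_independent P (fun jk : nat * nat => A jk.1 jk.2).
Hypothesis EA : forall j k, cexpectation P (A j k) = 0.
Hypothesis EA2 : forall j k, cexpectation P (fun w => A j k w ^+ 2) = 0.
Hypothesis EnormA2 : forall j k,
  cexpectation P (fun w => `|A j k w| ^+ 2) = (2 * v)%:C.

Let gC k : R[i] := (gauss_moment v k)%:C.

Definition matrix_eval n (w : Omega) : entry_poly R[i] n -> R[i] :=
  @entry_poly_eval R[i] n (fun t => (entry_part A w t)%:C).

Let Re_matrix_eval n w (p : entry_poly R[i] n) : cRe (matrix_eval w p) =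
  \sum_(m <- mpoly.msupp p) cRe (mpoly.mcoeff m p) *
    \prod_i entry_part A w (enum_val i) ^+ mpoly.fun_of_multinom m i.
Proof.
rewrite /matrix_eval /entry_poly_eval mpoly.mevalE raddf_sum /=.
apply: eq_bigr => m _.
under eq_bigr do rewrite -rmorphXn.
rewrite -rmorph_prod /=.
by case: (mpoly.mcoeff m p) => x y /=; rewrite mulr0 subr0.
Qed.

Lemma integrable_Re_matrix_eval n (p : entry_poly R[i] n) :
  integrable_rv P (fun w => cRe (matrix_eval w p)).
Proof.
under eq_fun do rewrite Re_matrix_eval.
apply: integrable_rv_sum => m; apply: integrable_rvZ.
exact: (integrable_entry_monomial A_gauss A_indep EA).
Qed.

Lemma integral_Re_matrix_eval n (p : entry_poly R[i] n) :
  \int[P]_w cRe (matrix_eval w p) = cRe (ginibre_mean gC p).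
Proof.
under eq_Rintegral do rewrite Re_matrix_eval.
have im (m : mpoly.multinom #|{: entry_index n}|) :=
  integrable_entry_monomial A_gauss A_indep EA m.
rewrite RintegralT_sum => [|m]; last exact: integrable_rvZ.
rewrite /ginibre_mean /gaussian_functional raddf_sum /=; apply: eq_bigr => m _.
rewrite RintegralT_Z// (integral_entry_monomial A_gauss A_indep EA EA2 EnormA2).
rewrite /gC -rmorph_prod /=.
by case: (mpoly.mcoeff m p) => x y /=; rewrite mulr0 subr0.
Qed.

Let M n w := laguerre_mx A n w.

Lemma laguerre_mx_herm n w : (M n w)^t* = M n w.
Proof.
rewrite /M /laguerre_mx linearZ /= map_mxZ fmorphV rmorph_nat.
rewrite trmx_mul map_mxM; congr (_ *: (_ *m _)).
apply/matrixP => i j; rewrite !mxE; exact: conjCK.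
Qed.

Lemma matrix_eval_wishart n w k :
  matrix_eval w (wishart_trace 'i n k) = \tr ((corner A n w *m (corner A n w)^t*) ^+ k).
Proof.
rewrite /matrix_eval eval_wishart_trace; congr (\tr ((_ *m _) ^+ k)).
  apply/matrixP => i j; rewrite !mxE /entry_part /=.
  by rewrite [RHS]complexE complexiE.
apply/matrixP => i j; rewrite !mxE /entry_part /=.
rewrite -complexiE; case: (A j i w) => x y; apply/eqP; rewrite eq_complex /=.
by apply/andP; split; apply/eqP; ring.
Qed.

Definition spectrum n w : seq R := [seq cRe z | z <- eigenvalues (M n w)].

Lemma size_spectrum n w : size (spectrum n w) = n.
Proof. by rewrite size_map size_eigenvalues. Qed.

Lemma average_spectrum n w k : (average (spectrum n.+1 w) (fun x => x ^+ k))%:C =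
  n.+1%:R ^- k.+1 * matrix_eval w (wishart_trace 'i n.+1 k).
Proof.
rewrite /average size_spectrum big_map rmorphM rmorph_sum /= fmorphV rmorph_nat.
rewrite matrix_eval_wishart.
transitivity (n.+1%:R^-1 * \tr ((M n.+1 w) ^+ k)).
  congr (_ * _); rewrite (trace_exp_eigenvalues (laguerre_mx_herm _ _)).
  rewrite [LHS]big_seq [RHS]big_seq; apply: eq_bigr => z zM.
  by rewrite rmorphXn /= RRe_real// (eigenvalues_real (laguerre_mx_herm _ _) zM).
rewrite /M /laguerre_mx exprZn linearZ /= mulrA; congr (_ * _).
by rewrite exprVn exprS invfM.
Qed.

Variable b : nat -> R.
Hypothesis b_0 : b 0 = 1.
Hypothesis b_S : forall k, b k.+1 = 2 * v * \sum_(l < k.+1) b l * b (k - l)%N.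

Let deviation n k : entry_poly R[i] n.+1 :=
  n.+1%:R ^- k.+1 *: wishart_trace 'i n.+1 k - (b k)%:C *: 1.

Let square_deviationE n w k :
  (average (spectrum n.+1 w) (fun x => x ^+ k) - b k) ^+ 2 =
  cRe (matrix_eval w (deviation n k ^+ 2)).
Proof.
have -> : matrix_eval w (deviation n k ^+ 2) =
    ((average (spectrum n.+1 w) (fun x => x ^+ k) - b k) ^+ 2)%:C.
  rewrite rmorphXn rmorphB /= average_spectrum /matrix_eval rmorphXn rmorphB /=.
  by rewrite !entry_poly_evalZ rmorph1 mulr1.
by [].
Qed.

Lemma integrable_square_deviation n k : integrable_rv P (fun w =>
  (average (spectrum n.+1 w) (fun x => x ^+ k) - b k) ^+ 2).
Proof.
under eq_fun do rewrite square_deviationE.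
exact: integrable_Re_matrix_eval.
Qed.

(** The squared deviation is again a polynomial in the entries. Its
    expectation combines mixed moments with two, one and no factors, and the
    limits of the three contributions cancel. *)
Lemma variance_bound k : exists2 K, 0 <= K & forall n,
  \int[P]_w ((average (spectrum n.+1 w) (fun x => x ^+ k) - b k) ^+ 2) <=
  K / n.+1%:R ^+ 2.
Proof.
have gC0 : gC 0 = 1 by [].
have gC1 : gC 1 = 0 by [].
have gCS j : gC j.+2 = v%:C * j.+1%:R * gC j.
  by rewrite /gC /= !rmorphM /= rmorph_nat.
have bC0 : (b 0)%:C = 1 by rewrite b_0.
have bCS j : (b j.+1)%:C = 2 * v%:C * \sum_(l < j.+1) (b l)%:C * (b (j - l)%N)%:C.
  rewrite b_S !rmorphM rmorph_sum rmorph_nat /=; congr (_ * _).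
  by apply: eq_bigr => l _; rewrite rmorphM.
have im2 : 'i * 'i = -1 :> R[i] by rewrite -expr2 sqrCi.
have [M1 M10 H1] := @wishart_moment_close _ _ gC v%:C (fun j => (b j)%:C)
  im2 gC0 gC1 gCS bC0 bCS [:: k].
have [M2 M20 H2] := @wishart_moment_close _ _ gC v%:C (fun j => (b j)%:C)
  im2 gC0 gC1 gCS bC0 bCS [:: k; k].
pose KC := M2 + `|2 * (b k)%:C| * M1.
have KC0 : 0 <= KC by rewrite addr_ge0// mulr_ge0.
have KCr : (cRe KC)%:C = KC by rewrite RRe_real// ger0_real.
exists (cRe KC) => [|n].
  by move: KC0; rewrite -KCr lecR.
under eq_Rintegral do rewrite square_deviationE.
rewrite integral_Re_matrix_eval -lecR rmorphM fmorphV rmorphXn rmorph_nat /= KCr.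
apply: (@le_trans _ _ `|ginibre_mean gC (deviation n k ^+ 2)|).
  by rewrite (le_trans _ (normc_ge_Re _))// lecR ler_norm.
have -> : ginibre_mean gC (deviation n k ^+ 2) =
    (wishart_moment 'i gC n.+1 [:: k; k] - (b k)%:C * (b k)%:C) -
    2 * (b k)%:C * (wishart_moment 'i gC n.+1 [:: k] - (b k)%:C).
  rewrite /wishart_moment !big_cons !big_nil !mulr1 /= !addn0 /deviation.
  set t := wishart_trace _ _ _; set c := n.+1%:R ^- k.+1; set bk := (b k)%:C.
  have -> : (c *: t - bk *: 1) ^+ 2 =
      c ^+ 2 *: (t * t) - (2 * bk * c) *: t + bk ^+ 2 *: 1.
    rewrite sqrrB !exprZn expr1n -expr2 -scalerAl -scalerAr mulr1 scalerA.
    by rewrite -scaler_nat scalerA; congr (_ - _ *: _ + _); ring.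
  rewrite raddfD raddfB /= !linearZ /=.
  have -> : ginibre_mean gC (1 : entry_poly R[i] n.+1) = 1.
    rewrite -[1]mpoly.mpolyX0 /ginibre_mean gaussian_functionalX big1// => i _.
    by rewrite mpoly.mnm0E.
  have -> : c ^+ 2 = n.+1%:R ^- (2 + (k + k)).
    by rewrite /c exprVn -exprM; congr (_ ^+ _)^-1; rewrite muln2 -addnn addSn addnS.
  by rewrite /GRing.scale /=; ring.
rewrite (le_trans (ler_normB _ _))// /KC [leRHS]mulrDl lerD//.
  by have := H2 n; rewrite !big_cons big_nil mulr1.
rewrite normrM -mulrA ler_wpM2l//.
by have := H1 n; rewrite !big_cons big_nil mulr1.
Qed.

End laguerre_variance.

(** * Almost sure convergence *)

Section summable_expectations.
Context {R : realType} {d : measure_display} {Omega : measurableType d}.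
Variables (P : probability Omega R).

Lemma sum_inv_square_le (N : nat) : \sum_(0 <= n < N) (n.+1%:R ^+ 2)^-1 <= 2 :> R.
Proof.
(* the sharper bound is inductive *)
suff H : \sum_(0 <= n < N) (n.+1%:R ^+ 2)^-1 <= 2 - 2 / N.+1%:R :> R.
  by rewrite (le_trans H)// gerBl divr_ge0.
elim: N => [|N IH]; first by rewrite big_geq// divr1 subrr.
rewrite big_nat_recr//= (le_trans (lerD IH (lexx _)))//.
have N0 : 0 < N.+1%:R :> R by rewrite ltr0n.
have -> : N.+2%:R = N.+1%:R + 1 :> R by rewrite natr1.
move: (N.+1%:R : R) N0 (ler1n R N.+1) => x x0 /= x1.
have x1' : 1 <= x by rewrite x1.
have xn0 : x != 0 by rewrite gt_eqF.
have yn0 : x + 1 != 0 by rewrite gt_eqF// addr_gt0.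
rewrite -subr_ge0.
have -> : 2 - 2 / (x + 1) - (2 - 2 / x + (x ^+ 2)^-1) = (x - 1) / (x ^+ 2 * (x + 1)).
  by field; rewrite xn0 yn0.
by rewrite divr_ge0 ?subr_ge0// mulr_ge0 ?sqr_ge0// addr_ge0// ltW.
Qed.

(** The sum of the [Z n] has a finite expectation, hence is almost surely
    finite. *)
Lemma ae_cvg0_of_summable (Z : nat -> Omega -> R) (K : R) :
  (forall n w, 0 <= Z n w) -> (forall n, integrable_rv P (Z n)) -> 0 <= K ->
  (forall n, \int[P]_w Z n w <= K / n.+1%:R ^+ 2) ->
  {ae P, forall w, Z n w @[n --> \oo] --> 0}.
Proof.
move=> Z0 iZ K0 ZK.
have mZ n : measurable_fun setT (fun w => (Z n w)%:E).
  by have := measurable_int _ (iZ n).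
pose S w : \bar R := (\sum_(0 <= n <oo) (Z n w)%:E)%E.
have S0 w : (0 <= S w)%E by apply: nneseries_ge0 => n _ _; rewrite lee_fin.
have mS : measurable_fun setT S.
  apply: ge0_emeasurable_sum => [n w _ _|n _]; [by rewrite lee_fin|exact: mZ].
have ES : (\int[P]_w S w <= (K * 2)%:E)%E.
  rewrite integral_nneseries//; last by move=> n w _; rewrite lee_fin.
  apply: lime_le.
    by apply: is_cvg_nneseries => n _ _; apply: integral_ge0 => w _; rewrite lee_fin.
  apply: nearW => N.
  have E n : (\int[P]_w (Z n w)%:E = (\int[P]_w Z n w)%:E)%E.
    by rewrite /Rintegral fineK// integrable_fin_num//; exact: iZ.
  under eq_bigr do rewrite E.
  rewrite sumEFin lee_fin (@le_trans _ _ (\sum_(0 <= n < N) K / n.+1%:R ^+ 2))//.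
    by apply: ler_sum => n _; exact: ZK.
  by rewrite -mulr_sumr ler_wpM2l// sum_inv_square_le.
have iS : P.-integrable setT S.
  apply/integrableP; split => //.
  have -> : (\int[P]_w `|S w| = \int[P]_w S w)%E.
    by apply: eq_integral => w _; rewrite gee0_abs.
  by rewrite (le_lt_trans ES)// ltry.
have := integrable_ae measurableT iS; apply: filterS => w /(_ I) Sw.
apply: cvg_series_cvg_0; apply: nondecreasing_is_cvgn.
  apply/nondecreasing_seqP => n; rewrite /series /= big_nat_recr//= lerDl; exact: Z0.
exists (fine (S w)) => _ [n _ <-].
rewrite -lee_fin fineK// /series /= -sumEFin.
by apply: nneseries_lim_ge => k _ _; rewrite lee_fin.
Qed.

End summable_expectations.

Unset Implicit Arguments.
Set Strict Implicit.
Set Printing Implicit Defensive.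

Theorem theorem2p2 (R : realType) (d : measure_display)
    (Omega : measurableType d) (P : probability Omega R)
    (a : R) (A : nat -> nat -> Omega -> R[i])
    (a_gt0 : 0 < a)
    (A_gauss : forall j k, complex_gaussian P (A j k))
    (A_indep : mutually_independent P (fun jk : nat * nat => A jk.1 jk.2))
    (EA : forall j k, cexpectation P (A j k) = 0)
    (EA2 : forall j k, cexpectation P (fun w => A j k w ^+ 2) = 0)
    (EnormA2 : forall j k,
      cexpectation P (fun w => `|A j k w| ^+ 2) = (2 * a ^+ 2)%:C) :
  {ae P, forall w,
    weak_cvg (fun n => eigencount (laguerre_mx A n w)) (laguerre_law a)}.
Proof.
pose L := 8 * a ^+ 2.
have L0 : 0 < L by rewrite mulr_gt0// exprn_gt0.
pose b k := density_mean (mp_density L) (fun x => x ^+ k).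
have b0 : b 0 = 1.
  rewrite /b /density_mean -[RHS](integral_mp_density L0).
  by apply: eq_Rintegral => x _; rewrite expr0 mul1r.
have bS k : b k.+1 = 2 * a ^+ 2 * \sum_(l < k.+1) b l * b (k - l)%N.
  apply: catalan_convolution => // j.
  by rewrite /b mp_momentS// /L; congr (_ * _ * _); field.
have moments : {ae P, forall w, forall k,
    average (spectrum A n w) (fun x => x ^+ k) @[n --> \oo] --> b k}.
  apply/ae_foralln => k.
  have [K K0 HK] := variance_bound A_gauss A_indep EA EA2 EnormA2 b0 bS k.
  have := ae_cvg0_of_summable (fun n w => sqr_ge0 _)
    (fun n => integrable_square_deviation A_gauss A_indep EA b n k) K0 HK.
  apply: filterS => w Hw; rewrite -(cvg_shiftS (fun n => average _ _)).
  apply/cvgrPdist_le => e e0.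
  have e20 : 0 < e ^+ 2 by rewrite exprn_gt0.
  have He : \forall n \near \oo,
      (average (spectrum A n.+1 w) (fun x => x ^+ k) - b k) ^+ 2 < e ^+ 2.
    by apply: (cvgr_lt _ Hw).
  near=> n; have Hn : (average (spectrum A n.+1 w) (fun x => x ^+ k) - b k) ^+ 2 < e ^+ 2.
    by near: n.
  rewrite distrC -ler_sqr ?nnegrE ?(ltW e0)// real_normK ?num_real//.
  exact: ltW.
apply: filterS moments => w Hw f cf [M [Mreal fM]].
have mf : measurable_fun setT f by exact: continuous_measurable_fun.
have {}fM x : `|f x| <= M + 1 by apply: (fM (M + 1)) => //; rewrite ltrDl.
have mpd := @measurable_mp_density R L.
have mpi := integrable_mp_density L0.
rewrite (integral_laguerre_law a_gt0 mf).
have -> : (\int[lebesgue_measure]_x (f x * mp_density L x)%:E =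
    (density_mean (mp_density L) f)%:E)%E.
  rewrite /density_mean /Rintegral fineK//; apply: integrable_fin_num => //.
  exact: (integrable_density_mean (mp_density_ge0 L0) mpd mpi (@mp_density_support R L)
    mf (fun x _ => fM x)).
under eq_fun do rewrite (integral_eigencount _ mf).
apply: cvg_EFin; first exact: nearW.
exact: (average_cvg (ltW L0) (mp_density_ge0 L0) mpd mpi (integral_mp_density L0)
  (@mp_density_support R L) (fun n => size_spectrum A n w) Hw cf fM).
Unshelve. all: by end_near. Qed.
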